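(* Let $p,q,r$ be natural numbers, let $\mathcal D_r\subset\mathcal M_{p,q}(\mathbb R)$ be the manifold of real $p\times q$ matrices of rank exactly $r$, and let $E\subset\mathcal M_{p,q}(\mathbb R)$ be an affine subspace. Let $\varphi(M)=\Pi_{E\cap T_{\Pi_{\mathcal D_r}(M)}\mathcal D_r}(M)$ and let $\Phi(M)=\lim_{i\to\infty}\varphi^i(M)$ be the limit of the sequence $M_0=M$, $M_{i+1}=\varphi(M_i)$. The limit operator $\Phi$ is well defined and continuous around any point $\zeta\in E\cap\mathcal D_r$ such that $\mathcal D_r$ and $E$ intersect transversally at $\zeta$, and $\Phi$ satisfies $\Phi(\zeta)=\Pi_{E\cap\mathcal D_r}(\zeta)=\zeta$. Moreover, $\Phi$ is differentiable at $\zeta$ and $$D\Phi(\zeta)=D\Pi_{E\cap\mathcal D_r}(\zeta)=\Pi_{T_\zeta(E\cap\mathcal D_r)^0}.$$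
   Context: $\mathcal M_{p,q}(\mathbb R)$ is the space of real $p\times q$ matrices with inner product $\langle M_1,M_2\rangle=\mathrm{trace}(M_1M_2^{\intercal})$ and the associated Frobenius norm. For an affine space $F$, $F^0$ denotes its underlying vector space. For a manifold $\mathcal V$ embedded in a Euclidean space and $x\in\mathcal V$, $T_x\mathcal V=x+T_x\mathcal V^0$ is the affine tangent space at $x$, with underlying vector space $T_x\mathcal V^0$. For a set $S$, $\Pi_S(x)$ denotes the (unique) point of $S$ nearest to $x$ when it is well defined; for a linear or affine subspace it is the orthogonal projection. $E$ and $\mathcal V$ intersect transversally at $\zeta\in E\cap\mathcal V$ if $\mathrm{codim}(E^0\cap T_\zeta\mathcal V^0)=\mathrm{codim}(E^0)+\mathrm{codim}(T_\zeta\mathcal V^0)$. When $E$ and $\mathcal D_r$ intersect transversally at $\zeta$, $E\cap\mathcal D_r$ is a manifold near $\zeta$, and $T_\zeta(E\cap\mathcal D_r)^0$ is its tangent vector space at $\zeta$. ''Around $\zeta$'' means on some open neighborhood of $\zeta$. *)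

(* Defs.v *)
From HB Require Import structures.
From mathcomp Require Import all_boot all_order all_algebra.
From mathcomp Require Import all_classical all_reals all_analysis.

Set Implicit Arguments.
Unset Strict Implicit.
Unset Printing Implicit Defensive.

Import Order.TTheory GRing.Theory Num.Theory.
Import numFieldNormedType.Exports.

Local Open Scope classical_set_scope.
Local Open Scope ring_scope.

Section Definitions.
Variables (R : realType) (p q : nat).
Local Notation Mat := 'M[R]_(p, q).
Implicit Types (S V E : set Mat) (U : {vspace Mat}) (x y : Mat) (r : nat).

(* Distances are Frobenius distances. The library's norm on matrices is the
   sup norm, used below only through the topology and the differential, which
   are the same for all norms on a finite-dimensional space. *)
Definition mxinner x y : R := \tr (x *m y^T).
Definition frobenius x : R := Num.sqrt (mxinner x x).

Definition is_nearest S x y : Prop :=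
  S y /\ forall z, S z -> z <> y -> frobenius (x - y) < frobenius (x - z).

(* Strictness above makes the nearest point unique. *)
Definition metric_proj_defined S x : Prop := exists y, is_nearest S x y.

(* The value is [x], and meaningless, outside [metric_proj_defined S]. *)
Definition metric_proj S x : Mat := xget x (is_nearest S x).

Definition is_affine_space E U : Prop :=
  exists a, E = [set a + v | v in [set` U]].

(* Tangent vector space at [x] of an embedded submanifold: the velocities at
   [x] of the curves drawn on it. For an embedded C^1 submanifold, curves
   differentiable at the base point give the same velocities as C^1 ones. *)
Definition tangent_vectors V x : set Mat :=
  [set v | exists gamma : R -> Mat,
    [/\ gamma 0 = x, \forall t \near (0 : R), V (gamma t)
      & is_derive (0 : R) (1 : R) gamma v]].

Definition tangent_space V x : set Mat :=
  [set x + v | v in tangent_vectors V x].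

Definition codim U : nat := (\dim {:Mat} - \dim U)%N.

(* [tangent_vectors] is a mere set: [T0] is that set as a subspace, so as to
   have a dimension. *)
Definition transversal_at U V x : Prop :=
  exists T0 : {vspace Mat}, [set` T0] = tangent_vectors V x /\
    codim (U :&: T0)%VS = (codim U + codim T0)%N.

Definition rank_manifold r : set Mat := [set M | \rank M = r].

Definition phi_target E r x : set Mat :=
  E `&` tangent_space (rank_manifold r) (metric_proj (rank_manifold r) x).

Definition phi_defined E r x : Prop :=
  metric_proj_defined (rank_manifold r) x /\
  metric_proj_defined (phi_target E r x) x.

Definition phi E r x : Mat := metric_proj (phi_target E r x) x.

Definition phi_iter E r x (i : nat) : Mat := iter i (phi E r) x.

Definition Phi_defined E r x : Prop :=
  (forall i, phi_defined E r (phi_iter E r x i)) /\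
  cvgn (phi_iter E r x).

Definition Phi E r x : Mat := limn (phi_iter E r x).

End Definitions.

Arguments rank_manifold : clear implicits.

(* Main.v *)
(* Near [zeta] the rank [r] matrices are the zeros of a Schur complement [F], whose
   differential [L x] is Lipschitz in [x], and transversality gives [L x] a right
   inverse with values in [E0], bounded uniformly for [x] near [zeta].  Hence, for
   [M] in [E], [phi M - M = O(F M)] and [F (phi M) = O((F M)^2)]: the iteration
   converges geometrically and uniformly, its limit [Phi] is continuous, takes its
   values in [W] and satisfies [Phi M - M = O(F M)] on [E].

   A set with such a retraction has unique nearest points: if [y] in [W] is nearest
   to [M], comparing it with the retraction of [y + t (z - y)] gives
   [<M - y, z - y> <= c |M - y| |z - y|^2] for [z] in [W], and adding two of these
   inequalities makes the projection Lipschitz.  This applies both to the rank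
   manifold and to [W].

   Finally [W], and the affine space onto which [phi] projects, agree with the tangent
   affine space of [W] at [zeta] up to [O(h^2)] at distance [h] from [zeta]; as the
   projection onto an affine space is stable, [Phi M] and the nearest point of [M] in
   [W] are within [O(h^(3/2))] of the orthogonal projection of [M] onto it. *)

Require Import Defs.
From HB Require Import structures.
From mathcomp Require Import all_boot all_order all_algebra.
From mathcomp Require Import all_classical all_reals all_analysis.
From mathcomp Require Import ring lra zify.

Set Implicit Arguments.
Unset Strict Implicit.
Unset Printing Implicit Defensive.

Import Order.TTheory GRing.Theory Num.Theory.
Import numFieldNormedType.Exports.

Local Open Scope classical_set_scope.
Local Open Scope ring_scope.

(** * Frobenius norm and nearest points *)

(** [phi] is a Newton step for the equation [F = 0] on [E], linearised at the rank [r] matrix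
    nearest to [M] instead of at [M]; hence the quadratic gain, of which only a halving of [F] is
    kept. No implicit function theorem or parametrisation of [W] enters: a retraction takes its
    place. For the rank manifold it is explicit, and for [W] it is [Phi] itself, so convergence has
    to come before anything is known about nearest points of [W]. The domain shrinks as each
    operation becomes available: [d] for the chart, [proj_radius] for the nearest rank [r] matrix,
    [phi_radius] for the halving, [Phi_radius] for whole orbits. This is why every estimate carries
    explicit constants. The residual bounds hold on [E] only, whereas [M] is arbitrary. Since [phi]
    takes its values in [E], the first step is treated apart, hence the shifts by one in the
    iteration. The exponent 3/2 arises because [W] is not affine: nearest points are compared
    through squared distances, where an error [h^2] on a distance of order [h] costs [h^3]. Squares
    are kept to the end, so no fractional power appears. *)

Section Frobenius.
Context {R : realType}.
Implicit Types m n k : nat.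

Lemma mxinnerE m n (x y : 'M[R]_(m, n)) :
  mxinner x y = \sum_i \sum_j x i j * y i j.
Proof.
rewrite /mxinner /mxtrace; apply: eq_bigr => i _; rewrite mxE.
by apply: eq_bigr => j _; rewrite mxE.
Qed.

Lemma mxinnerC m n (x y : 'M[R]_(m, n)) : mxinner x y = mxinner y x.
Proof.
by rewrite !mxinnerE; apply: eq_bigr => i _; apply: eq_bigr => j _; rewrite mulrC.
Qed.

Lemma mxinnerDl m n (x y z : 'M[R]_(m, n)) :
  mxinner (x + y) z = mxinner x z + mxinner y z.
Proof. by rewrite /mxinner mulmxDl mxtraceD. Qed.

Lemma mxinnerZl m n a (x y : 'M[R]_(m, n)) :
  mxinner (a *: x) y = a * mxinner x y.
Proof. by rewrite /mxinner -scalemxAl mxtraceZ. Qed.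

Lemma mxinnerDr m n (x y z : 'M[R]_(m, n)) :
  mxinner z (x + y) = mxinner z x + mxinner z y.
Proof. by rewrite !(mxinnerC z) mxinnerDl. Qed.

Lemma mxinnerZr m n a (x y : 'M[R]_(m, n)) :
  mxinner y (a *: x) = a * mxinner y x.
Proof. by rewrite !(mxinnerC y) mxinnerZl. Qed.

Lemma mxinnerNl m n (x y : 'M[R]_(m, n)) : mxinner (- x) y = - mxinner x y.
Proof. by rewrite -scaleN1r mxinnerZl mulN1r. Qed.

Lemma mxinnerNr m n (x y : 'M[R]_(m, n)) : mxinner y (- x) = - mxinner y x.
Proof. by rewrite -scaleN1r mxinnerZr mulN1r. Qed.

Lemma mxinner_ge0 m n (x : 'M[R]_(m, n)) : 0 <= mxinner x x.
Proof.
by rewrite mxinnerE; do 2!(apply: sumr_ge0 => ? _); rewrite -expr2 sqr_ge0.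
Qed.

Lemma frobenius_ge0 m n (x : 'M[R]_(m, n)) : 0 <= frobenius x.
Proof. exact: sqrtr_ge0. Qed.
Hint Resolve frobenius_ge0 : core.

Lemma sqr_frobenius m n (x : 'M[R]_(m, n)) : frobenius x ^+ 2 = mxinner x x.
Proof. by rewrite sqr_sqrtr // mxinner_ge0. Qed.

Lemma sqr_frobeniusE m n (x : 'M[R]_(m, n)) :
  frobenius x ^+ 2 = \sum_i \sum_j x i j ^+ 2.
Proof.
rewrite sqr_frobenius mxinnerE.
by apply: eq_bigr => i _; apply: eq_bigr => j _; rewrite expr2.
Qed.

Lemma sqr_frobeniusD m n (x y : 'M[R]_(m, n)) :
  frobenius (x + y) ^+ 2 =
  frobenius x ^+ 2 + 2 * mxinner x y + frobenius y ^+ 2.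
Proof. by rewrite !sqr_frobenius !(mxinnerDl, mxinnerDr) (mxinnerC y x); ring. Qed.

Lemma frobeniusZ m n a (x : 'M[R]_(m, n)) :
  frobenius (a *: x) = `|a| * frobenius x.
Proof.
by rewrite /frobenius mxinnerZl mxinnerZr mulrA -expr2 sqrtrM ?sqr_ge0 // sqrtr_sqr.
Qed.

Lemma frobeniusN m n (x : 'M[R]_(m, n)) : frobenius (- x) = frobenius x.
Proof. by rewrite -scaleN1r frobeniusZ normrN1 mul1r. Qed.

Lemma frobeniusBC m n (x y : 'M[R]_(m, n)) : frobenius (x - y) = frobenius (y - x).
Proof. by rewrite -opprB frobeniusN. Qed.

Lemma frobenius0 m n : frobenius (0 : 'M[R]_(m, n)) = 0.
Proof. by rewrite -(scale0r 0) frobeniusZ normr0 mul0r. Qed.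

Lemma sqr_frobeniusB m n (x y : 'M[R]_(m, n)) :
  frobenius (x - y) ^+ 2 =
  frobenius x ^+ 2 - 2 * mxinner x y + frobenius y ^+ 2.
Proof. by rewrite sqr_frobeniusD frobeniusN mxinnerNr; ring. Qed.

Lemma frobenius_entry m n (x : 'M[R]_(m, n)) i j : `|x i j| <= frobenius x.
Proof.
rewrite -(@ler_pXn2r _ 2) ?nnegrE // real_normK ?num_real // sqr_frobeniusE.
rewrite (bigD1 i) //= (bigD1 j) //= -addrA lerDl addr_ge0 //.
  by apply: sumr_ge0 => ? _; exact: sqr_ge0.
by do 2!(apply: sumr_ge0 => ? _); exact: sqr_ge0.
Qed.

Lemma frobenius0_eq0 m n (x : 'M[R]_(m, n)) : frobenius x = 0 -> x = 0.
Proof.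
move=> x0; apply/matrixP => i j; apply/eqP; rewrite mxE -normr_le0 -x0.
exact: frobenius_entry.
Qed.

Lemma mxinner_le m n (x y : 'M[R]_(m, n)) :
  mxinner x y <= frobenius x * frobenius y.
Proof.
have [y0|yn0] := eqVneq (frobenius y) 0.
  by rewrite y0 mulr0 (frobenius0_eq0 y0) -(scale0r 0) mxinnerZr mul0r.
have [x0|xn0] := eqVneq (frobenius x) 0.
  by rewrite x0 mul0r (frobenius0_eq0 x0) -(scale0r 0) mxinnerZl mul0r.
have p : 0 < frobenius x * frobenius y by rewrite mulr_gt0 // lt0r ?xn0 ?yn0 /=.
rewrite -(ler_pM2l p).
have := sqr_ge0 (frobenius (frobenius y *: x - frobenius x *: y)).
rewrite sqr_frobeniusB !frobeniusZ !ger0_norm // mxinnerZl mxinnerZr; nra.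
Qed.

Lemma mxinner_norm_le m n (x y : 'M[R]_(m, n)) :
  `|mxinner x y| <= frobenius x * frobenius y.
Proof.
by rewrite ler_norml mxinner_le andbT lerNl -mxinnerNl -(frobeniusN x) mxinner_le.
Qed.

Lemma frobeniusD m n (x y : 'M[R]_(m, n)) :
  frobenius (x + y) <= frobenius x + frobenius y.
Proof.
rewrite -(@ler_pXn2r _ 2) ?nnegrE ?addr_ge0 // sqr_frobeniusD.
have := mxinner_le x y; nra.
Qed.

Lemma frobenius_dist_tri m n (z x y : 'M[R]_(m, n)) :
  frobenius (x - y) <= frobenius (x - z) + frobenius (z - y).
Proof. by rewrite -{1}(subrK z x) -addrA frobeniusD. Qed.

Lemma frobeniusB m n (x y : 'M[R]_(m, n)) :
  frobenius (x - y) <= frobenius x + frobenius y.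
Proof. by rewrite -(frobeniusN y) frobeniusD. Qed.

Lemma CauchySchwarz_sum n (a b : 'I_n -> R) :
  (\sum_i a i * b i) ^+ 2 <= (\sum_i a i ^+ 2) * (\sum_i b i ^+ 2).
Proof.
have nE (c : 'I_n -> R) : frobenius (\row_i c i) ^+ 2 = \sum_i c i ^+ 2.
  by rewrite sqr_frobeniusE big_ord1; apply: eq_bigr => i _; rewrite mxE.
have iE : mxinner (\row_i a i) (\row_i b i) = \sum_i a i * b i.
  by rewrite mxinnerE big_ord1; apply: eq_bigr => i _; rewrite !mxE.
rewrite -!nE -iE -exprMn -(real_normK (num_real (mxinner _ _))).
by rewrite ler_pXn2r ?nnegrE ?mulr_ge0 // mxinner_norm_le.
Qed.

Lemma frobeniusM m n k (x : 'M[R]_(m, n)) (y : 'M[R]_(n, k)) :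
  frobenius (x *m y) <= frobenius x * frobenius y.
Proof.
rewrite -(@ler_pXn2r _ 2) ?nnegrE ?mulr_ge0 // exprMn !sqr_frobeniusE.
rewrite [X in _ <= _ * X]exchange_big /= mulr_suml; apply: ler_sum => i _.
rewrite mulr_sumr; apply: ler_sum => j _; rewrite mxE.
exact: CauchySchwarz_sum.
Qed.

Lemma mx_norm_le_frobenius m n (x : 'M[R]_(m, n)) : `|x| <= frobenius x.
Proof.
rewrite [`|x|]mx_normrE; apply/bigmax_leP; split => // -[i j] _ /=.
exact: frobenius_entry.
Qed.

Lemma entry_le_mx_norm m n (x : 'M[R]_(m, n)) i j : `|x i j| <= `|x|.
Proof.
by rewrite [leRHS]mx_normrE; apply/bigmax_geP; right; exists (i, j).
Qed.

Lemma frobenius_le_mx_norm m n :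
  exists2 c : R, 0 < c & forall x : 'M[R]_(m, n), frobenius x <= c * `|x|.
Proof.
exists (1 + (m * n)%:R) => [|x]; first by rewrite ltr_wpDr.
rewrite -(@ler_pXn2r _ 2) ?nnegrE ?mulr_ge0 ?addr_ge0 // sqr_frobeniusE.
apply: (@le_trans _ _ (\sum_(i < m) \sum_(j < n) `|x| ^+ 2)).
  do 2!(apply: ler_sum => ? _); rewrite -real_normK ?num_real //.
  by rewrite ler_pXn2r ?nnegrE // entry_le_mx_norm.
rewrite !sumr_const !card_ord -mulrnA mulnC -[leLHS]mulr_natl exprMn.
apply: ler_wpM2r; first exact: sqr_ge0.
by have := ler0n R (m * n); nra.
Qed.

(** The bridge from sup-norm neighborhoods to Frobenius balls, so that local statements can be
    proved with explicit Frobenius radii. *)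
Lemma nbhs_frobenius m n (x : 'M[R]_(m, n)) (P : set 'M[R]_(m, n)) :
  (\forall y \near x, P y) <->
  exists2 d : R, 0 < d & forall y, frobenius (y - x) < d -> P y.
Proof.
have [c c0 cle] := frobenius_le_mx_norm m n; split.
- move=> /nbhs_ballP[d /= d0 dP]; exists d => // y yd; apply: dP.
  rewrite -ball_normE /= distrC.
  exact: le_lt_trans (mx_norm_le_frobenius _) yd.
- move=> [d d0 dP]; apply/nbhs_ballP; exists (d / c); first exact: divr_gt0.
  move=> y; rewrite -ball_normE /= distrC ltr_pdivlMr // mulrC => yd.
  by apply: dP; exact: le_lt_trans (cle _) yd.
Qed.

End Frobenius.
#[global] Hint Extern 0 (is_true (0 <= frobenius _)) =>
  solve [apply: frobenius_ge0] : core.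

(** * Topology of matrix spaces through the Frobenius norm *)

Section Topology.
Context {R : realType}.
Implicit Types m n k : nat.

Lemma frobenius_sum m n (I : finType) (F : I -> 'M[R]_(m, n)) :
  frobenius (\sum_i F i) <= \sum_i frobenius (F i).
Proof.
elim/big_ind2: _ => [|u v w z uv wz|//]; first by rewrite frobenius0.
by rewrite (le_trans (frobeniusD _ _)) ?lerD.
Qed.

Lemma linear_frobenius_bounded m n k l (f : {linear 'M[R]_(m, n) -> 'M[R]_(k, l)}) :
  exists2 c : R, 1 <= c & forall x, frobenius (f x) <= c * frobenius x.
Proof.
pose c := \sum_i \sum_j frobenius (f (delta_mx i j)).
have c0 : 0 <= c by rewrite /c; do 2!(apply: sumr_ge0 => ? _).
exists (1 + c) => [|x]; first by rewrite lerDl.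
apply: (@le_trans _ _ (c * frobenius x)); last by have := frobenius_ge0 x; nra.
rewrite {1}(matrix_sum_delta x) linear_sum /c mulr_suml.
apply: le_trans (frobenius_sum _) _; apply: ler_sum => i _.
rewrite linear_sum mulr_suml.
apply: le_trans (frobenius_sum _) _; apply: ler_sum => j _.
by rewrite linearZ frobeniusZ mulrC ler_wpM2l ?frobenius_entry.
Qed.

Lemma frobenius_lipschitz_continuous m n k l (f : 'M[R]_(m, n) -> 'M[R]_(k, l)) c :
  1 <= c -> (forall x y, frobenius (f x - f y) <= c * frobenius (x - y)) ->
  continuous f.
Proof.
move=> c1 fc x A /= /nbhs_frobenius[d d0 dA].
apply/nbhs_frobenius; exists (d / c) => [|y yd]; first by rewrite divr_gt0 //; lra.
apply: dA; apply: le_lt_trans (fc _ _) _; rewrite mulrC -ltr_pdivlMr //; lra.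
Qed.

Lemma linear_mx_continuous m n k l (f : {linear 'M[R]_(m, n) -> 'M[R]_(k, l)}) :
  continuous f.
Proof.
have [c c1 fc] := linear_frobenius_bounded f.
by apply: (frobenius_lipschitz_continuous c1) => x y; rewrite -linearB.
Qed.

Lemma frobenius_dist_continuous m n (x : 'M[R]_(m, n)) :
  continuous (fun y : 'M[R]_(m, n) => frobenius (x - y)).
Proof.
move=> y B /= /nbhs_ballP[e /= e0 eB]; apply/nbhs_frobenius; exists e => // z ze.
apply: eB; rewrite /ball /= ltr_norml; have := frobenius_dist_tri y x z.
have := frobenius_dist_tri z x y; rewrite (frobeniusBC y z); lra.
Qed.

Lemma frobenius_closed m n (A : set 'M[R]_(m, n)) :
  (forall x, (forall e, 0 < e -> exists2 y, A y & frobenius (y - x) < e) -> A x) ->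
  closed A.
Proof.
move=> Acl x Ax; apply: Acl => e e0.
have [|y [Ay ye]] := Ax [set y | frobenius (y - x) < e]; last by exists y.
by apply/nbhs_frobenius; exists e.
Qed.

Lemma closed_frobenius m n (A : set 'M[R]_(m, n)) x : closed A ->
  (forall e, 0 < e -> exists2 y, A y & frobenius (y - x) < e) -> A x.
Proof.
move=> Acl H; apply: Acl => B /nbhs_frobenius[d d0 dB].
by have [y Ay yd] := H d d0; exists y; split => //; exact: dB.
Qed.

Lemma closed_frobenius_ball m n (x : 'M[R]_(m, n)) (r : R) :
  closed [set y | frobenius (x - y) <= r].
Proof.
apply: (@preimage_closed _ _ (fun y : 'M[R]_(m, n) => frobenius (x - y)) [set t | t <= r]) => //.
  by move=> y _; exact: frobenius_dist_continuous.
Qed.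

(** [U] is the zero set of the bounded map [\1 - projv U]; a nonzero value at [x] would keep the
    points of [U] at a positive distance from [x]. *)
Lemma closed_vspace m n (U : {vspace 'M[R]_(m, n)}) : closed [set` U].
Proof.
pose f := (\1 - projv U)%VF.
have [c c1 fc] := linear_frobenius_bounded f.
have fE v : f v = v - projv U v by rewrite add_lfunE opp_lfunE id_lfunE.
have f0 v : v \in U -> f v = 0.
  by move=> vU; rewrite fE projv_id // subrr.
apply: frobenius_closed => x H.
suff fx : f x = 0.
  have : x - projv U x = 0 by rewrite -fE.
  by move/eqP; rewrite subr_eq0 => /eqP -> /=; exact: memv_proj.
apply: frobenius0_eq0; apply/eqP; rewrite -[_ == _]negbK; apply/negP => fx.
have {}fx : 0 < frobenius (f x) by rewrite lt0r fx /=.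
have [|y /= yU yx] := H (frobenius (f x) / c); first by rewrite divr_gt0 //; lra.
have := fc (x - y); rewrite linearB /= (f0 y yU) subr0 leNgt frobeniusBC.
by move: yx; rewrite ltr_pdivlMr ?(mulrC c) => [->//|]; lra.
Qed.

(** Cutting [A] by the closed ball of radius [frobenius (x - a)] around [x] leaves a compact set, on
    which the distance has a minimum; points outside the ball are farther than [a]. Compactness is
    taken on row vectors, through [vec_mx]. *)
Lemma closed_nearest m n (A : set 'M[R]_(m, n)) x : closed A -> A !=set0 ->
  exists2 y, A y & forall z, A z -> frobenius (x - y) <= frobenius (x - z).
Proof.
move=> Acl [a Aa].
pose B := A `&` [set y | frobenius (x - y) <= frobenius (x - a)].
have Bcl : closed B by apply: closedI => //; exact: closed_frobenius_ball.
pose v : 'rV[R]_(m * n) -> 'M[R]_(m, n) := vec_mx.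
have vc : continuous v by exact: linear_mx_continuous.
have [c c1 mxvec_le] := linear_frobenius_bounded (@mxvec R m n).
have cB : compact (v @^-1` B).
  apply: bounded_closed_compact; last by apply: preimage_closed => // *; exact: vc.
  exists (c * (frobenius x + frobenius (x - a))); split; first exact: num_real.
  move=> M ltM w [_ /= wa]; apply/ltW; apply: le_lt_trans ltM.
  apply: le_trans (mx_norm_le_frobenius _) _; rewrite -(vec_mxK w).
  apply: le_trans (mxvec_le _) _; rewrite ler_wpM2l //; first by lra.
  by have := frobeniusB x (x - v w); rewrite opprB addrC subrK /v; lra.
have Bn0 : v @^-1` B !=set0 by exists (mxvec a); split; rewrite /= /v mxvecK.
have [|w /set_mem[Aw wa] wmin] := EVT_min_rV (f := fun w => frobenius (x - v w)) Bn0 cB.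
  apply: continuous_subspaceT => w.
  exact: (@continuous_comp _ _ _ v _ w (vc w) (@frobenius_dist_continuous _ _ x (v w))).
exists (v w) => // z Az; have [za|/ltW za] := leP (frobenius (x - z)) (frobenius (x - a)).
  have := wmin (mxvec z); rewrite /v mxvecK; apply; apply/mem_set.
  by split; rewrite /= /v mxvecK.
exact: le_trans za.
Qed.

End Topology.

(** * Nearest points, and the case of affine subspaces *)

Section Nearest.
Context {R : realType} {m n : nat}.
Implicit Types (S A : set 'M[R]_(m, n)) (x y z : 'M[R]_(m, n)).

Lemma is_nearest_metric_proj S x y : is_nearest S x y -> metric_proj S x = y.
Proof.
move=> [Sy ymin]; rewrite /metric_proj; case: xgetP => [z _ [Sz zmin]|/(_ y)[]//].
apply: contrapT => zy; have := ymin z Sz zy.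
by have := zmin y Sy (fun e => zy (esym e)); lra.
Qed.

Lemma metric_projP S x : metric_proj_defined S x -> is_nearest S x (metric_proj S x).
Proof. by move=> [y xy]; rewrite (is_nearest_metric_proj xy). Qed.

Lemma metric_proj_in S x : metric_proj_defined S x -> S (metric_proj S x).
Proof. by case/metric_projP. Qed.

Lemma metric_proj_le S x z : metric_proj_defined S x -> S z ->
  frobenius (x - metric_proj S x) <= frobenius (x - z).
Proof.
move=> /metric_projP[Sy ymin] Sz; have [->//|/eqP zy] := eqVneq z (metric_proj S x).
exact/ltW/ymin.
Qed.

Lemma metric_proj_id S x : S x -> metric_proj S x = x.
Proof.
move=> Sx; apply: is_nearest_metric_proj; split => // z Sz zx.
rewrite subrr frobenius0 lt0r frobenius_ge0 andbT; apply/eqP => /frobenius0_eq0/eqP.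
by rewrite subr_eq0 => /eqP/esym.
Qed.

(** Affine subspaces without a named base point or direction, which suits both linear subspaces and
    the targets of [phi]. *)
Definition line_closed A := forall a b t, A a -> A b -> A (a + t *: (b - a)).

(** The first-order condition at a minimum, without derivatives: divide by [t] and let [t] tend to
    0. *)
Lemma quadratic_ge0_linear_le0 (a b : R) :
  (forall t, 0 < t -> t <= 1 -> 2 * t * a <= t ^+ 2 * b) -> a <= 0.
Proof.
move=> H; rewrite leNgt; apply/negP => a0.
have [b0|b0] := leP b 0; first by have := H 1 ltr01 (lexx _); nra.
(* With this [t], [t * b = a - t * a < a], against [2 * a <= t * b]. *)
pose t := a / (a + b).
have ab : 0 < a + b by lra.
have t0 : 0 < t by rewrite divr_gt0.
have t1 : t <= 1 by rewrite ler_pdivrMr // mul1r; lra.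
have := H t t0 t1; have : t * (a + b) = a by rewrite divfK // gt_eqF.
nra.
Qed.

Lemma line_closed_orthogonal A x y z : line_closed A -> A y -> A z ->
  (forall w, A w -> frobenius (x - y) <= frobenius (x - w)) ->
  mxinner (x - y) (z - y) = 0.
Proof.
move=> Al Ay Az ymin.
(* [s] is set to 1 and to -1: the line through [y] and [z] can be followed both ways, which turns
   the one-sided condition into an equality. *)
have key (s t : R) : 2 * t * (s * mxinner (x - y) (z - y)) <=
                     t ^+ 2 * (s ^+ 2 * frobenius (z - y) ^+ 2).
  have := ymin _ (Al y z (t * s) Ay Az).
  rewrite -(@ler_pXn2r _ 2) ?nnegrE // opprD addrA (sqr_frobeniusB (x - y)).
  rewrite frobeniusZ mxinnerZr exprMn real_normK ?num_real //; nra.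
apply/eqP; rewrite eq_le; apply/andP; split.
  by apply: (quadratic_ge0_linear_le0 (b := frobenius (z - y) ^+ 2)) => t _ _;
     have := key 1 t; nra.
rewrite -oppr_le0; apply: (quadratic_ge0_linear_le0 (b := frobenius (z - y) ^+ 2)) => t _ _.
have := key (-1) t; nra.
Qed.

Lemma line_closed_pythagoras A x y z : line_closed A -> A y -> A z ->
  (forall w, A w -> frobenius (x - y) <= frobenius (x - w)) ->
  frobenius (x - z) ^+ 2 = frobenius (x - y) ^+ 2 + frobenius (z - y) ^+ 2.
Proof.
move=> Al Ay Az ymin; have o := line_closed_orthogonal Al Ay Az ymin.
have -> : x - z = (x - y) - (z - y) by rewrite opprB addrA subrK.
by rewrite sqr_frobeniusB o; ring.
Qed.

Lemma line_closed_metric_proj_defined A x : line_closed A -> closed A ->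
  A !=set0 -> metric_proj_defined A x.
Proof.
move=> Al Acl A0; have [y Ay ymin] := closed_nearest x Acl A0.
exists y; split => // z Az zy; rewrite -(@ltr_pXn2r _ 2) ?nnegrE //.
rewrite (line_closed_pythagoras Al Ay Az ymin) ltrDl exprn_gt0 //.
rewrite lt0r frobenius_ge0 andbT; apply/eqP => /frobenius0_eq0/eqP.
by rewrite subr_eq0 => /eqP.
Qed.

(* Two sets that are close to each other near the nearest points have close
   nearest points, as soon as one of them is affine. *)
Lemma nearest_stability A0 A x0 x y0 y y' y'' e : line_closed A0 ->
  A0 y0 -> (forall w, A0 w -> frobenius (x0 - y0) <= frobenius (x0 - w)) ->
  (forall w, A w -> frobenius (x - y) <= frobenius (x - w)) ->
  A y' -> A0 y'' -> frobenius (x - x0) <= e -> frobenius (y' - y0) <= e ->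
  frobenius (y'' - y) <= e ->
  frobenius (y'' - y0) ^+ 2 <= 8 * e * frobenius (x0 - y0) + 16 * e ^+ 2.
Proof.
move=> Al Ay0 y0min ymin Ay' Ay'' xx0 y'y0 y''y.
(* Going through [x], [y] and the competitor [y'] gives [frobenius (x0 - y'') <= frobenius (x0 - y0)
   + 4 * e]; squaring this and subtracting by Pythagoras yields the bound. *)
have := line_closed_pythagoras Al Ay0 Ay'' y0min.
have := ymin _ Ay'.
have := frobenius_dist_tri x x0 y''; have := frobenius_dist_tri y x y''.
have := frobenius_dist_tri x0 x y'; have := frobenius_dist_tri y0 x0 y'.
rewrite (frobeniusBC x0 x) (frobeniusBC y0 y') (frobeniusBC y y'').
have := frobenius_ge0 (x0 - y''); have := frobenius_ge0 (x0 - y0).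
move: (frobenius _) (frobenius _) (frobenius _) => *.
nra.
Qed.

End Nearest.
(** * The rank manifold as the zero set of a Schur complement *)

Section SchurComplement.
Context {R : realType} {r m n : nat}.
Variables (P1 : 'M[R]_(r, r + m)) (P2 : 'M[R]_(m, r + m)) (R2 : 'M[R]_(r + m, m)).
Variables (Q1 : 'M[R]_(r + n, r)) (Q2 : 'M[R]_(r + n, n)) (U2 : 'M[R]_(n, r + n)).
Hypotheses (Punit : col_mx P1 P2 \in unitmx) (Qunit : row_mx Q1 Q2 \in unitmx).
Hypotheses (P1R2 : P1 *m R2 = 0) (P2R2 : P2 *m R2 = 1%:M).
Hypotheses (U2Q1 : U2 *m Q1 = 0) (U2Q2 : U2 *m Q2 = 1%:M).
Implicit Types x y h : 'M[R]_(r + m, r + n).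

(* In the block form [A B; C D'] of [x] given by the row bases [P1], [P2] and the
   column bases [Q1], [Q2], the equation of the rank [r] matrices is
   [D' - C A^-1 B = 0]; [schur_diff x] is the differential of its left-hand side
   at a point [x] of rank [r]. *)
Definition schur_pivot x : 'M[R]_r := P1 *m x *m Q1.
Definition schur_row x : 'M[R]_(m, r + m) :=
  P2 - (P2 *m x *m Q1) *m invmx (schur_pivot x) *m P1.
Definition schur_col x : 'M[R]_(r + n, n) :=
  Q2 - Q1 *m (invmx (schur_pivot x) *m (P1 *m x *m Q2)).
Definition schur_complement x : 'M[R]_(m, n) := schur_row x *m x *m Q2.
Definition schur_diff x h : 'M[R]_(m, n) := schur_row x *m h *m schur_col x.
(** In block form, [D'] is replaced by [C A^-1 B] and the other three blocks are kept; [R2] and [U2]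
    place a block in the lower right corner. *)
Definition schur_retract x := x - R2 *m schur_complement x *m U2.

Lemma schur_row_pivot x : schur_pivot x \in unitmx -> schur_row x *m x *m Q1 = 0.
Proof.
move=> xu; rewrite /schur_row !mulmxBl -!mulmxA (mulmxA P1) -/(schur_pivot x).
by rewrite mulVmx // mulmx1 subrr.
Qed.

Lemma schur_col_pivot x : schur_pivot x \in unitmx -> P1 *m x *m schur_col x = 0.
Proof.
move=> xu; rewrite /schur_col mulmxBr !mulmxA -/(schur_pivot x).
by rewrite mulmxV // mul1mx subrr.
Qed.

(* The freedom in [x] is what makes the Taylor estimate immediate: for [x] of
   rank [r], [schur_row x] kills [x] on the left. *)
Lemma schur_complementE x y : schur_pivot y \in unitmx ->
  schur_complement y = schur_row x *m y *m schur_col y.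
Proof.
move=> yu; rewrite {1}/schur_row !mulmxBl -!(mulmxA _ P1) -(mulmxA _ (P1 *m y)).
rewrite schur_col_pivot // mulmx0 subr0 /schur_col mulmxBr !mulmxA.
by rewrite /schur_complement /schur_row !mulmxBl.
Qed.

Lemma schur_row_mul x : schur_pivot x \in unitmx -> schur_complement x = 0 ->
  schur_row x *m x = 0.
Proof.
move=> xu x0; apply: (row_free_inj (A := row_mx Q1 Q2)).
  by rewrite row_free_unit.
by rewrite /= mul0mx mul_mx_row schur_row_pivot // -/(schur_complement x) x0 row_mx0.
Qed.

Lemma schur_taylor x y : schur_pivot x \in unitmx -> schur_pivot y \in unitmx ->
  schur_complement x = 0 ->
  schur_complement y - schur_diff x (y - x) =
  schur_row x *m (y - x) *m (schur_col y - schur_col x).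
Proof.
move=> xu yu x0; rewrite (schur_complementE x) // /schur_diff.
by rewrite !(mulmxBr (schur_row x)) schur_row_mul // subr0 -mulmxBr.
Qed.

(** Block elimination: clearing the rows and columns against the pivot amounts to multiplying by
    invertible matrices, and leaves a block diagonal matrix made of the pivot and the Schur
    complement. *)
Lemma rank_schur_complement x : schur_pivot x \in unitmx ->
  \rank x = (r + \rank (schur_complement x))%N.
Proof.
move=> xu.
have lE : col_mx P1 (schur_row x) =
    block_mx 1%:M 0 (- ((P2 *m x *m Q1) *m invmx (schur_pivot x))) 1%:M *m col_mx P1 P2.
  by rewrite mul_block_col !mul1mx mul0mx addr0 mulNmx addrC.
have rE : row_mx Q1 (schur_col x) = row_mx Q1 Q2 *m
    block_mx 1%:M (- (invmx (schur_pivot x) *m (P1 *m x *m Q2))) 0 1%:M.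
  by rewrite mul_row_block !mulmx1 mulmx0 addr0 mulmxN addrC.
have lu : col_mx P1 (schur_row x) \in unitmx.
  by rewrite lE unitmx_mul Punit andbT unitmxE det_lblock !det1 mulr1 unitr1.
have ru : row_mx Q1 (schur_col x) \in unitmx.
  by rewrite rE unitmx_mul Qunit /= unitmxE det_ublock !det1 mulr1 unitr1.
have <- : \rank (col_mx P1 (schur_row x) *m x *m row_mx Q1 (schur_col x)) = \rank x.
  rewrite mxrankMfree ?row_free_unit //.
  by rewrite -mxrank_tr trmx_mul mxrankMfree ?mxrank_tr // row_free_unit unitmx_tr.
rewrite mul_col_mx mul_col_row -/(schur_pivot x) schur_row_pivot // schur_col_pivot //.
by rewrite -(schur_complementE x) // rank_diag_block_mx mxrank_unit.
Qed.

Lemma rank_eq_schur_complement x : schur_pivot x \in unitmx ->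
  \rank x = r <-> schur_complement x = 0.
Proof.
move=> xu; rewrite rank_schur_complement //; split=> [|->]; last by rewrite mxrank0 addn0.
by move/eqP; rewrite -{2}(addn0 r) eqn_add2l mxrank_eq0 => /eqP.
Qed.

Lemma schur_row_section x : schur_row x *m R2 = 1%:M.
Proof. by rewrite mulmxBl P2R2 -(mulmxA _ P1) P1R2 mulmx0 subr0. Qed.

Lemma schur_col_section x : U2 *m schur_col x = 1%:M.
Proof. by rewrite mulmxBr U2Q2 mulmxA U2Q1 mul0mx subr0. Qed.

Lemma schur_retractE x : schur_pivot x \in unitmx ->
  schur_pivot (schur_retract x) = schur_pivot x /\
  schur_complement (schur_retract x) = 0.
Proof.
move=> xu.
have P1x : P1 *m schur_retract x = P1 *m x.
  by rewrite mulmxBr !mulmxA P1R2 !mul0mx subr0.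
have xQ1 : schur_retract x *m Q1 = x *m Q1.
  by rewrite mulmxBl -!mulmxA U2Q1 !mulmx0 subr0.
have e : schur_pivot (schur_retract x) = schur_pivot x by rewrite /schur_pivot P1x.
split => //; rewrite /schur_complement /schur_row e -(mulmxA _ _ Q1) xQ1 mulmxA.
rewrite -/(schur_row x) /schur_retract mulmxBr mulmxBl !mulmxA schur_row_section.
by rewrite mul1mx -(mulmxA _ U2) U2Q2 mulmx1 subrr.
Qed.

(** Changing the lower right block alone produces any value: the differential is onto. *)
Lemma schur_diff_section x z : schur_diff x (R2 *m z *m U2) = z.
Proof.
by rewrite /schur_diff !mulmxA schur_row_section mul1mx -mulmxA schur_col_section mulmx1.
Qed.

End SchurComplement.

(** * Calculus of bounded Lipschitz matrix functions *)

Section BoundedLipschitz.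
Context {R : realType} {m n : nat} (S : set 'M[R]_(m, n)).
Implicit Types k l o : nat.

(** The bound is part of the notion because products of Lipschitz functions need it; the class is
    then stable under products and, near the identity, under inverses, which gives uniform estimates
    on [schur_row] and [schur_col]. *)
Definition bounded_lipschitz k l (f : 'M[R]_(m, n) -> 'M[R]_(k, l)) :=
  exists2 c : R, 0 <= c & forall x y, S x -> S y ->
    frobenius (f x) <= c /\ frobenius (f x - f y) <= c * frobenius (x - y).

Lemma bounded_lipschitz_cst k l (a : 'M[R]_(k, l)) : bounded_lipschitz (fun=> a).
Proof.
by exists (frobenius a) => // x y _ _; rewrite subrr frobenius0 mulr_ge0.
Qed.

Lemma bounded_lipschitzB k l (f g : 'M[R]_(m, n) -> 'M[R]_(k, l)) :
  bounded_lipschitz f -> bounded_lipschitz g -> bounded_lipschitz (fun x => f x - g x).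
Proof.
move=> [a a0 af] [b b0 bg]; exists (a + b) => [|x y Sx Sy]; first exact: addr_ge0.
have [fx fxy] := af x y Sx Sy; have [gx gxy] := bg x y Sx Sy; split.
  by apply: le_trans (frobeniusB _ _) _; exact: lerD.
have -> : f x - g x - (f y - g y) = (f x - f y) - (g x - g y).
  by rewrite !opprB addrACA (addrC (- g x)) addrACA.
by apply: le_trans (frobeniusB _ _) _; rewrite mulrDl; exact: lerD.
Qed.

Lemma frobeniusM_le k l o (a b : R) (x : 'M[R]_(k, l)) (y : 'M[R]_(l, o)) :
  frobenius x <= a -> frobenius y <= b -> frobenius (x *m y) <= a * b.
Proof. by move=> xa yb; apply: le_trans (frobeniusM _ _) _; exact: ler_pM. Qed.

Lemma bounded_lipschitzM k l o (f : 'M[R]_(m, n) -> 'M[R]_(k, l))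
    (g : 'M[R]_(m, n) -> 'M[R]_(l, o)) :
  bounded_lipschitz f -> bounded_lipschitz g -> bounded_lipschitz (fun x => f x *m g x).
Proof.
move=> [a a0 af] [b b0 bg]; exists (2 * (a * b)) => [|x y Sx Sy].
  by rewrite !mulr_ge0.
have [fx fxy] := af x y Sx Sy; have [gx gxy] := bg x y Sx Sy.
have [gy _] := bg y x Sy Sx; split.
  by have := frobeniusM_le fx gx; have := mulr_ge0 a0 b0; lra.
have -> : f x *m g x - f y *m g y = f x *m (g x - g y) + (f x - f y) *m g y.
  by rewrite mulmxBr mulmxBl addrA subrK.
apply: le_trans (frobeniusD _ _) _.
by have := frobeniusM_le fx gxy; have := frobeniusM_le fxy gy; lra.
Qed.

Lemma bounded_lipschitz_linear k l (f : {linear 'M[R]_(m, n) -> 'M[R]_(k, l)}) z (d : R) :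
  (forall x, S x -> frobenius (x - z) <= d) -> bounded_lipschitz f.
Proof.
move=> Sd; have [c c1 fc] := linear_frobenius_bounded f.
exists (c + frobenius (f z) + c * `|d|) => [|x y Sx Sy].
  by rewrite !addr_ge0 ?mulr_ge0 //; lra.
split; last first.
  rewrite -linearB; apply: le_trans (fc _) _; rewrite ler_wpM2r // -addrA lerDl.
  by rewrite addr_ge0 ?mulr_ge0 //; lra.
have -> : f x = f (x - z) + f z by rewrite -linearD subrK.
apply: le_trans (frobeniusD _ _) _.
have := fc (x - z); have := ler_norm d; have := Sd _ Sx; nra.
Qed.

(** A row vector killed by [a] equals [- v *m (a - 1%:M)], so its norm is at most half of itself.
    Likewise [invmx a = 1%:M - invmx a *m (a - 1%:M)] bounds the inverse; [frobenius 1%:M] stays in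
    the bound since it is not 1 in general. *)
Lemma near_id_unitmx k (a : 'M[R]_k) : frobenius (a - 1%:M) <= 2^-1 ->
  a \in unitmx /\ frobenius (invmx a) <= 2 * frobenius (1%:M : 'M[R]_k).
Proof.
move=> a1.
have au : a \in unitmx.
  rewrite -row_free_unit; apply: inj_row_free => v va.
  have vE : v = - (v *m (a - 1%:M)) by rewrite mulmxBr va mulmx1 sub0r opprK.
  apply: frobenius0_eq0; apply/eqP; rewrite eq_le frobenius_ge0 andbT.
  have := frobeniusM v (a - 1%:M); rewrite -frobeniusN -vE.
  have := frobenius_ge0 v; nra.
split => //; have E : invmx a = 1%:M - invmx a *m (a - 1%:M).
  by rewrite mulmxBr mulVmx // mulmx1 subKr.
have := frobeniusB 1%:M (invmx a *m (a - 1%:M)); rewrite -E.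
have := frobeniusM (invmx a) (a - 1%:M); have := frobenius_ge0 (invmx a); nra.
Qed.

Lemma bounded_lipschitzV k (f : 'M[R]_(m, n) -> 'M[R]_k) :
  (forall x, S x -> frobenius (f x - 1%:M) <= 2^-1) ->
  bounded_lipschitz f -> bounded_lipschitz (fun x => invmx (f x)).
Proof.
move=> f1 [c c0 cf]; pose b := 2 * frobenius (1%:M : 'M[R]_k).
have b0 : 0 <= b by rewrite mulr_ge0.
exists (b + b * c * b) => [|x y Sx Sy]; first by rewrite addr_ge0 ?mulr_ge0.
have [xu xb] := near_id_unitmx (f1 x Sx); have [yu yb] := near_id_unitmx (f1 y Sy).
split; first by apply: le_trans xb _; rewrite lerDl !mulr_ge0.
have -> : invmx (f x) - invmx (f y) = invmx (f x) *m (f y - f x) *m invmx (f y).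
  by rewrite mulmxBr mulmxBl mulVmx // mul1mx -mulmxA mulmxV // mulmx1.
have fyx : frobenius (f y - f x) <= c * frobenius (x - y).
  by rewrite frobeniusBC; case: (cf x y Sx Sy).
have := frobeniusM_le (frobeniusM_le xb fyx) yb; rewrite -/b.
by have := mulr_ge0 b0 (frobenius_ge0 (x - y)); lra.
Qed.

End BoundedLipschitz.

Lemma mulmx3_sub {R : realType} a b c e (x x' : 'M[R]_(a, b)) (h : 'M[R]_(b, c))
    (y y' : 'M[R]_(c, e)) :
  x *m h *m y - x' *m h *m y' = x *m h *m (y - y') + (x - x') *m h *m y'.
Proof. by rewrite mulmxBr !mulmxBl addrA subrK. Qed.

(** * Local equations with quantitative estimates, and the one of the rank manifold *)

Section Chart.
Context {R : realType} {m n k l : nat}.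
Local Notation V := 'M[R]_(m, n).
Local Notation Z := 'M[R]_(k, l).

(** A quantitative local equation of [D], with one radius and one constant for all estimates. The
    Taylor bound has its base point on [D]: this is the form of [schur_taylor], and [phi] linearises
    at points of [D]. *)
Record is_chart (D : set V) (zeta : V) (F : V -> Z) (L : V -> {linear V -> Z}) (d C : R) : Prop
:= IsChart {
  chart_radius_gt0 : 0 < d;
  chart_cst_ge1 : 1 <= C;
  chartE : forall x, frobenius (x - zeta) < d -> D x <-> F x = 0;
  chart_taylor : forall x y, frobenius (x - zeta) < d -> frobenius (y - zeta) < d ->
    D x -> frobenius (F y - L x (y - x)) <= C * frobenius (y - x) ^+ 2;
  chart_lipschitz : forall x y h, frobenius (x - zeta) < d -> frobenius (y - zeta) < d ->
    frobenius (L x h - L y h) <= C * frobenius (x - y) * frobenius h;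
  chart_bounded : forall x h, frobenius (x - zeta) < d ->
    frobenius (L x h) <= C * frobenius h }.

End Chart.

Section RankChart.
Context {R : realType}.

Lemma schur_chart {r m n} (P1 : 'M[R]_(r, r + m)) (P2 : 'M[R]_(m, r + m))
    (R2 : 'M[R]_(r + m, m)) (Q1 : 'M[R]_(r + n, r)) (Q2 : 'M[R]_(r + n, n))
    (U2 : 'M[R]_(n, r + n)) (zeta : 'M[R]_(r + m, r + n)) :
  col_mx P1 P2 \in unitmx -> row_mx Q1 Q2 \in unitmx ->
  P1 *m R2 = 0 -> P2 *m R2 = 1%:M -> U2 *m Q1 = 0 -> U2 *m Q2 = 1%:M ->
  P1 *m zeta *m Q1 = 1%:M ->
  exists (F : 'M[R]_(r + m, r + n) -> 'M[R]_(m, n))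
    (L : 'M[R]_(r + m, r + n) -> {linear 'M[R]_(r + m, r + n) -> 'M[R]_(m, n)}) s d C,
  [/\ is_chart (rank_manifold R (r + m) (r + n) r) zeta F L d C,
      forall x, frobenius (x - zeta) < d -> rank_manifold R (r + m) (r + n) r (s x) /\
        frobenius (s x - x) <= C * frobenius (F x)
    & forall z, exists h, L zeta h = z].
Proof.
move=> Pu Qu + + + + z1.
pose A := schur_pivot P1 Q1; pose K := schur_row P1 P2 Q1; pose J := schur_col P1 Q1 Q2.
pose F := schur_complement P1 P2 Q1 Q2.
pose L x : {linear 'M[R]_(r + m, r + n) -> 'M[R]_(m, n)} := mulmxr (J x) \o mulmx (K x).
have [a a1 aA] := linear_frobenius_bounded (mulmxr Q1 \o mulmx P1).
(* On this ball the pivot, which is the identity at [zeta], moves by at most 1/2, so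
   [near_id_unitmx] makes it invertible with a bounded inverse. *)
pose d := (2 * a)^-1; pose S := [set x | frobenius (x - zeta) < d].
have a0 : 0 < a by exact: lt_le_trans ltr01 a1.
have d0 : 0 < d by rewrite invr_gt0 mulr_gt0.
have ad : a * d = 2^-1 by rewrite /d invfM mulrCA mulfV ?mulr1 // gt_eqF.
have A1 x : S x -> frobenius (A x - 1%:M) <= 2^-1.
  move=> Sx; rewrite -z1 /A /schur_pivot -mulmxBl -mulmxBr.
  by clear z1; move: Sx (aA (x - zeta)); rewrite /S /=; nra.
have Au x : S x -> A x \in unitmx by move=> /A1/near_id_unitmx[].
have Slin k l (f : {linear 'M[R]_(r + m, r + n) -> 'M[R]_(k, l)}) : bounded_lipschitz S f.
  by apply: (@bounded_lipschitz_linear _ _ _ _ _ _ _ zeta d) => x /ltW.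
have AV : bounded_lipschitz S (fun x => invmx (A x)).
  by apply: bounded_lipschitzV => //; exact: (Slin _ _ (mulmxr Q1 \o mulmx P1)).
have [cK cK0 cKP] : bounded_lipschitz S K.
  apply: bounded_lipschitzB (bounded_lipschitz_cst _ _) _.
  apply: bounded_lipschitzM (bounded_lipschitz_cst _ _).
  by apply: bounded_lipschitzM AV; exact: (Slin _ _ (mulmxr Q1 \o mulmx P2)).
have [cJ cJ0 cJP] : bounded_lipschitz S J.
  apply: bounded_lipschitzB (bounded_lipschitz_cst _ _) _.
  apply: bounded_lipschitzM (bounded_lipschitz_cst _ _) _.
  by apply: bounded_lipschitzM AV _; exact: (Slin _ _ (mulmxr Q2 \o mulmx P1)).
have cKJ : 0 <= cK * cJ by exact: mulr_ge0.
have cRU : 0 <= frobenius R2 * frobenius U2 by exact: mulr_ge0.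
(* [cK * cJ] bounds [L] and the Taylor coefficient, twice that the variation of [L], and the last
   term the displacement of the retraction. *)
pose C := 1 + 2 * (cK * cJ) + frobenius R2 * frobenius U2.
have rankE x : S x -> \rank x = r <-> F x = 0.
  by move=> Sx; apply: rank_eq_schur_complement => //; exact: Au.
move=> P1R2 P2R2 U2Q1 U2Q2; exists F, L, (schur_retract P1 P2 R2 Q1 Q2 U2), d, C; split.
- clear P1R2 P2R2 U2Q1 U2Q2 z1; split => //; first by rewrite /C; lra.
  + move=> x y Sx Sy /(rankE x Sx) Fx.
    rewrite /L /= (schur_taylor Qu) //; try exact: Au.
    have [Kx _] := cKP x y Sx Sy; have [_ Jyx] := cJP y x Sy Sx.
    have := frobeniusM_le (frobeniusM_le Kx (lexx (frobenius (y - x)))) Jyx.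
    move=> /le_trans; apply; have := sqr_ge0 (frobenius (y - x)).
    by rewrite /C; nra.
  + move=> x y h Sx Sy; rewrite /L /=.
    have [Kx Kxy] := cKP x y Sx Sy; have [Jx Jxy] := cJP x y Sx Sy.
    have [Jy _] := cJP y x Sy Sx.
    rewrite mulmx3_sub.
    apply: le_trans (frobeniusD _ _) _.
    have := frobeniusM_le (frobeniusM_le Kx (lexx (frobenius h))) Jxy.
    have := frobeniusM_le (frobeniusM_le Kxy (lexx (frobenius h))) Jy.
    have : 0 <= frobenius (x - y) * frobenius h by exact: mulr_ge0.
    rewrite /C; nra.
  + move=> x h Sx; rewrite /L /=.
    have [Kx _] := cKP x x Sx Sx; have [Jx _] := cJP x x Sx Sx.
    have := frobeniusM_le (frobeniusM_le Kx (lexx (frobenius h))) Jx.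
    have := frobenius_ge0 h; rewrite /C; nra.
- move=> x Sx; have [e s0] := schur_retractE P1R2 P2R2 U2Q1 U2Q2 (Au x Sx).
  split; first by apply/(rank_eq_schur_complement Pu Qu) => //; rewrite e; exact: Au.
  rewrite /schur_retract addrC addKr frobeniusN.
  have := frobeniusM_le (frobeniusM R2 (F x)) (lexx (frobenius U2)).
  clear P1R2 P2R2 U2Q1 U2Q2 z1 e s0.
  have := frobenius_ge0 (F x); rewrite -/F /C; nra.
- by move=> z; exists (R2 *m z *m U2); exact: schur_diff_section.
Qed.

(** Gaussian elimination of [zeta] supplies the bases: in them [zeta] has an identity pivot and
    zeros elsewhere. [R2] and [U2] are blocks of the inverses of [P] and [Q], whence the four
    product identities. *)
Lemma rank_chart {p q r} (zeta : 'M[R]_(p, q)) : \rank zeta = r ->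
  exists m n (F : 'M[R]_(p, q) -> 'M[R]_(m, n)) (L : 'M[R]_(p, q) -> {linear 'M[R]_(p, q) -> 'M[R]_(m, n)}) s d C,
  [/\ is_chart (rank_manifold R p q r) zeta F L d C,
      forall x, frobenius (x - zeta) < d -> rank_manifold R p q r (s x) /\
        frobenius (s x - x) <= C * frobenius (F x)
    & forall z, exists h, L zeta h = z].
Proof.
move=> rz.
have [m pE] : exists m, p = (r + m)%N.
  by exists (p - r)%N; rewrite subnKC // -rz rank_leq_row.
have [n qE] : exists n, q = (r + n)%N.
  by exists (q - r)%N; rewrite subnKC // -rz rank_leq_col.
subst p q; exists m, n.
pose P := invmx (col_ebase zeta); pose Q := invmx (row_ebase zeta).
have Pu : P \in unitmx by rewrite unitmx_inv col_ebase_unit.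
have Qu : Q \in unitmx by rewrite unitmx_inv row_ebase_unit.
have PzQ : P *m zeta *m Q = block_mx 1%:M 0 0 0.
  rewrite -pid_mx_block -{1}(mulmx_ebase zeta) rz !mulmxA mulVmx ?col_ebase_unit //.
  by rewrite mul1mx mulmxK // row_ebase_unit.
have := mulmxV Pu; rewrite scalar_mx_block => PV.
have := mulVmx Qu; rewrite scalar_mx_block => QV.
apply: (@schur_chart r m n (usubmx P) (dsubmx P) (rsubmx (invmx P))
          (lsubmx Q) (rsubmx Q) (dsubmx (invmx Q))).
- by rewrite vsubmxK.
- by rewrite hsubmxK.
- by rewrite mul_usub_mx mulmx_rsub PV block_mxEh row_mxKr col_mxKu.
- by rewrite mul_dsub_mx mulmx_rsub PV block_mxEh row_mxKr col_mxKd.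
- by rewrite mul_dsub_mx mulmx_lsub QV block_mxEh row_mxKl col_mxKd.
- by rewrite mul_dsub_mx mulmx_rsub QV block_mxEh row_mxKr col_mxKd.
- by rewrite !mul_usub_mx mulmx_lsub PzQ block_mxEh row_mxKl col_mxKu.
Qed.

End RankChart.
(** * Intersection of an affine space with a level set *)

Section RegularIntersection.
Context {R : realType} {m n k l : nat}.
Local Notation V := 'M[R]_(m, n).
Local Notation Z := 'M[R]_(k, l).

Lemma le_eps_le0 (a b : R) : (forall t, 0 < t -> t <= 1 -> a <= t * b) -> a <= 0.
Proof.
move=> H; apply: (quadratic_ge0_linear_le0 (b := 2 * b)) => t t0 t1.
by have := H t t0 t1; nra.
Qed.

Lemma is_derive0P (g : R -> V) v : is_derive (0 : R) (1 : R) g v <->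
  forall e : R, 0 < e -> exists2 a : R, 0 < a &
    forall t : R, t != 0 -> `|t| < a -> frobenius (t^-1 *: (g t - g 0) - v) < e.
Proof.
have eqv : (t^-1 *: (g t - g 0) @[t --> (0 : R)^'] --> v) <->
  forall e : R, 0 < e -> exists2 a : R, 0 < a &
    forall t : R, t != 0 -> `|t| < a -> frobenius (t^-1 *: (g t - g 0) - v) < e.
  split=> [gv e e0|H A /nbhs_frobenius[e e0 eA]].
    have /gv : nbhs v [set w | frobenius (w - v) < e] by apply/nbhs_frobenius; exists e.
    move=> /nbhs_ballP[a /= a0 aP]; exists a => // t t0 ta.
    by apply: aP => //; rewrite /ball /= sub0r normrN.
  have [a a0 aP] := H e e0; apply/nbhs_ballP; exists a => // t /= ta t0; apply: eA.
  by apply: aP => //; move: ta; rewrite /ball /= sub0r normrN.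
have E : (fun t : R => t^-1 *: ((g \o shift (0 : R)) (t *: (1 : R)) - g 0)) =
         (fun t => t^-1 *: (g t - g 0)).
  by apply/funext => t /=; rewrite addr0 [t *: _]mulr1.
split=> [[dg gE]|/eqv gv].
  by apply/eqv; move: dg; rewrite /derivable E => /cvg_ex[w gw]; rewrite -gE /derive E (cvg_lim _ gw).
by split; rewrite /derivable /derive E; [apply/cvg_ex; exists v | exact: cvg_lim].
Qed.

Variables (D E : set V) (E0 : {vspace V}) (zeta : V).
Variables (F : V -> Z) (L : V -> {linear V -> Z}) (s : V -> V) (d C : R).
Hypothesis chart : is_chart D zeta F L d C.
Hypothesis d1 : d <= 1.
Hypothesis EP : forall x, E x <-> x - zeta \in E0.
Hypothesis Dzeta : D zeta.
Hypothesis retract : forall x, E x -> frobenius (x - zeta) < d ->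
  (E `&` D) (s x) /\ frobenius (s x - x) <= C * frobenius (F x).
Local Notation W := (E `&` D).

Let d0 : 0 < d. Proof. exact: chart_radius_gt0 chart. Qed.
Let C1 : 1 <= C. Proof. exact: chart_cst_ge1 chart. Qed.

Lemma affine_base : E zeta.
Proof. by apply/EP; rewrite subrr mem0v. Qed.

Lemma affine_sub x y : E x -> E y -> y - x \in E0.
Proof.
move=> /EP Ex /EP Ey; have -> : y - x = (y - zeta) - (x - zeta).
  by rewrite opprB addrA subrK.
exact: memvB.
Qed.

Lemma affine_add x v : E x -> v \in E0 -> E (x + v).
Proof. by move=> /EP Ex v0; apply/EP; rewrite addrAC memvD. Qed.

(** The radius [d / 2] keeps limit points inside the chart. [F] is not assumed continuous: [F x] is
    bounded by the Taylor estimate based at points [y] of [D] tending to [x]. *)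
Lemma chart_closed : closed (D `&` [set x | frobenius (zeta - x) <= d / 2]).
Proof.
have clB : closed [set x : V | frobenius (zeta - x) <= d / 2].
  exact: closed_frobenius_ball.
apply: frobenius_closed => x H; have xd : frobenius (zeta - x) <= d / 2.
  by apply: (closed_frobenius clB) => e e0; have [y [_ yd] yx] := H e e0; exists y.
split => //; have d0' := d0.
have xd' : frobenius (x - zeta) < d by rewrite frobeniusBC; lra.
apply/(chartE chart xd'); apply: frobenius0_eq0; apply/eqP.
rewrite eq_le frobenius_ge0 andbT; apply: (le_eps_le0 (b := 2 * C)) => t t0 t1.
have [y [Dy /= yd] yx] := H t t0.
have yd' : frobenius (y - zeta) < d by rewrite frobeniusBC; lra.
have := chart_taylor chart yd' xd' Dy; have := chart_bounded chart (x - y) yd'.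
have := frobeniusD (F x - L y (x - y)) (L y (x - y)); rewrite subrK (frobeniusBC x y).
have C0 : 0 <= C by exact: le_trans ler01 C1.
have a2 : frobenius (y - x) ^+ 2 <= t by have := frobenius_ge0 (y - x); nra.
by have := ler_wpM2l C0 a2; have := ler_wpM2l C0 (ltW yx); lra.
Qed.

Lemma affine_closed : closed E.
Proof.
have -> : E = (fun x => x - zeta) @^-1` [set` E0] by apply/seteqP; split => x /EP.
apply: preimage_closed; last exact: closed_vspace.
move=> x _; apply: (frobenius_lipschitz_continuous (lexx 1)) => y z.
by rewrite opprB addrA subrK mul1r.
Qed.

(** The minimum is taken over the closed part of [W] within [d / 2] of [zeta]; beyond that, a point
    loses to [zeta] itself, which is within [d / 4] of [M]. *)
Lemma nearest_exists M : frobenius (M - zeta) < d / 4 ->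
  exists2 y, W y & forall z, W z -> frobenius (M - y) <= frobenius (M - z).
Proof.
move=> Md; have Kcl : closed (E `&` (D `&` [set x | frobenius (zeta - x) <= d / 2])).
  by apply: closedI; [exact: affine_closed | exact: chart_closed].
have d0' := d0.
have Kz : (E `&` (D `&` [set x | frobenius (zeta - x) <= d / 2])) zeta.
  by split; [exact: affine_base | split => //=; rewrite subrr frobenius0; lra].
have [|y [Ey [Dy _]] ymin] := closed_nearest M Kcl; first by exists zeta.
exists y => // z [Ez Dz]; have [zd|zd] := leP (frobenius (zeta - z)) (d / 2).
  by apply: ymin.
have := ymin _ Kz; have := frobenius_dist_tri M zeta z.
by rewrite (frobeniusBC zeta M); lra.
Qed.

(* Sliding from [y] towards [z] inside [W] along the retracted segment
   [s (y + t (z - y))] cannot decrease the distance to [M]. *)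
Lemma nearest_prox M y z : W y -> W z ->
  frobenius (y - zeta) < d / 3 -> frobenius (z - zeta) < d / 3 ->
  (forall w, W w -> frobenius (M - y) <= frobenius (M - w)) ->
  mxinner (M - y) (z - y) <=
    2 * C ^+ 2 * frobenius (M - y) * frobenius (z - y) ^+ 2.
Proof.
move=> [Ey Dy] [Ez Dz] yd zd ymin; have [d0' C1'] := (d0, C1).
have yd' : frobenius (y - zeta) < d by lra.
have zd' : frobenius (z - zeta) < d by lra.
set w := z - y.
have w2 : frobenius w <= 2 * d / 3.
  by have := frobenius_dist_tri zeta z y; rewrite (frobeniusBC zeta y) /w; lra.
have Lw : frobenius (L y w) <= C * frobenius w ^+ 2.
  have := chart_taylor chart yd' zd' Dy.
  by move/(chartE chart zd'): Dz => ->; rewrite sub0r frobeniusN.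
rewrite -subr_le0.
apply: (quadratic_ge0_linear_le0 (b := (frobenius w + 2 * C ^+ 2 * frobenius w ^+ 2) ^+ 2)).
move=> t t0 t1; have t_ge0 := ltW t0.
have xd : frobenius (y + t *: w - zeta) < d.
  rewrite addrAC; apply: le_lt_trans (frobeniusD _ _) _.
  by rewrite frobeniusZ ger0_norm //; have := frobenius_ge0 w; nra.
have Ex : E (y + t *: w) by apply: affine_add => //; rewrite memvZ // affine_sub.
(* [w] is a secant, not a tangent vector: [L y w] is only of order [|w|^2], so the retraction error
   is of order [t |w|^2]. This term, linear in [t], is the right-hand side of the lemma; the squared
   length of [u - y] is of order [t ^+ 2]. *)
have Fx : frobenius (F (y + t *: w)) <= 2 * C * t * frobenius w ^+ 2.
  have := chart_taylor chart yd' xd Dy; rewrite [_ + _ - y]addrAC subrr add0r linearZ /=.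
  have := frobeniusD (F (y + t *: w) - t *: L y w) (t *: L y w); rewrite subrK.
  rewrite !frobeniusZ ger0_norm // exprMn => h1 h2.
  apply: le_trans h1 _; apply: (@le_trans _ _ (C * (t ^+ 2 * frobenius w ^+ 2) + t * (C * frobenius w ^+ 2))).
    by apply: lerD => //; exact: ler_wpM2l.
  have k0 : 0 <= C * frobenius w ^+ 2 by rewrite mulr_ge0 ?sqr_ge0 //; lra.
  have t2 : t ^+ 2 <= t by nra.
  by have := ler_wpM2l k0 t2; lra.
have [Wu ux] := retract Ex xd.
set u := s (y + t *: w) in Wu ux.
have uE : u - y = t *: w + (u - (y + t *: w)) by rewrite opprD (addrC (- y)) addrCA addNKr.
have {}ux : frobenius (u - (y + t *: w)) <= 2 * C ^+ 2 * t * frobenius w ^+ 2 by nra.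
have uy : frobenius (u - y) <= t * (frobenius w + 2 * C ^+ 2 * frobenius w ^+ 2).
  rewrite uE; apply: le_trans (frobeniusD _ _) _.
  by rewrite frobeniusZ ger0_norm //; lra.
have uy2 : frobenius (u - y) ^+ 2 <= t ^+ 2 * (frobenius w + 2 * C ^+ 2 * frobenius w ^+ 2) ^+ 2.
  by rewrite -exprMn ler_pXn2r ?nnegrE //; apply: le_trans uy.
have : frobenius (M - y) ^+ 2 <= frobenius (M - u) ^+ 2.
  by rewrite ler_pXn2r ?nnegrE //; exact: ymin.
have -> : M - u = (M - y) - (u - y) by rewrite opprB addrA subrK.
rewrite (sqr_frobeniusB (M - y)) [in mxinner _ _]uE mxinnerDr mxinnerZr.
have := mxinner_norm_le (M - y) (u - (y + t *: w)); rewrite ler_norml => /andP[lo _].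
have : frobenius (M - y) * frobenius (u - (y + t *: w)) <=
       frobenius (M - y) * (2 * C ^+ 2 * t * frobenius w ^+ 2) by exact: ler_wpM2l.
lra.
Qed.

Lemma nearest_dist M y : (forall w, W w -> frobenius (M - y) <= frobenius (M - w)) ->
  frobenius (y - zeta) <= 2 * frobenius (M - zeta).
Proof.
move=> /(_ zeta (conj affine_base Dzeta)).
by have := frobenius_dist_tri M y zeta; rewrite (frobeniusBC y M); lra.
Qed.

(** Within this radius [2 * C ^+ 2 * frobenius (M - y) <= 4^-1] for a nearest point [y], so the two
    quadratic terms of [nearest_prox] together cost half of the squared distance; and [y] is within
    [d / 4] of [zeta], inside the range of [nearest_prox]. *)
Definition proj_radius := d / (8 * C ^+ 2).

Lemma proj_radiusP : [/\ 0 < proj_radius, proj_radius <= d / 8 & 2 * C ^+ 2 * proj_radius <= 4^-1].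
Proof.
have [d0' [C1' d1']] := (d0, (C1, d1)).
have e : proj_radius * (8 * C ^+ 2) = d.
  by rewrite divfK // gt_eqF // mulr_gt0 // exprn_gt0 //; lra.
have p0 : 0 < proj_radius by rewrite divr_gt0 // mulr_gt0 // exprn_gt0 //; lra.
split => //; last by lra.
have : 1 <= C ^+ 2 by rewrite exprn_ege1.
nra.
Qed.

Lemma nearest_lipschitz M1 M2 y1 y2 :
  frobenius (M1 - zeta) < proj_radius -> frobenius (M2 - zeta) < proj_radius ->
  W y1 -> W y2 -> (forall w, W w -> frobenius (M1 - y1) <= frobenius (M1 - w)) ->
  (forall w, W w -> frobenius (M2 - y2) <= frobenius (M2 - w)) ->
  frobenius (y1 - y2) <= 2 * frobenius (M1 - M2).
Proof.
move=> M1d M2d Wy1 Wy2 min1 min2; have [p0 pd pC] := proj_radiusP.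
have y1d := nearest_dist min1; have y2d := nearest_dist min2.
have := min1 zeta (conj affine_base Dzeta); have := min2 zeta (conj affine_base Dzeta).
have d0' := d0.
have y1d3 : frobenius (y1 - zeta) < d / 3 by lra.
have y2d3 : frobenius (y2 - zeta) < d / 3 by lra.
have := nearest_prox Wy1 Wy2 y1d3 y2d3 min1.
have := nearest_prox Wy2 Wy1 y2d3 y1d3 min2.
have := mxinner_le (M1 - M2) (y1 - y2).
have -> : mxinner (M2 - y2) (y1 - y2) = - mxinner (M2 - y2) (y2 - y1).
  by rewrite -mxinnerNr opprB.
have E1 : mxinner (M1 - y1) (y2 - y1) - mxinner (M2 - y2) (y2 - y1) =
    frobenius (y1 - y2) ^+ 2 - mxinner (M1 - M2) (y1 - y2).
  have -> : M1 - y1 = (M1 - M2) + (M2 - y2) + (y2 - y1).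
    by rewrite !addrA !subrK.
  rewrite (mxinnerDl (_ + _)) (mxinnerDl (M1 - M2)) -(sqr_frobenius (y2 - y1)) (frobeniusBC y1) -(opprB y2 y1) mxinnerNr; ring.
rewrite (frobeniusBC y2 y1).
move: E1 (frobenius_ge0 (y1 - y2)) (frobenius_ge0 (M1 - M2)) p0 pC M1d M2d.
set i1 := mxinner _ _; set i2 := mxinner _ _; set i3 := mxinner _ _.
set a := frobenius (y1 - y2); set b := frobenius (M1 - M2).
set e1 := frobenius (M1 - y1); set e2 := frobenius (M2 - y2).
move=> E1 a0 b0 p0 pC' M1d M2d h3 h2 h1 g2 g1.
have c0 : 0 <= 2 * C ^+ 2 by rewrite mulr_ge0 // sqr_ge0.
have k1 : 2 * C ^+ 2 * e1 * a ^+ 2 <= 4^-1 * a ^+ 2.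
  by apply: ler_wpM2r; [exact: sqr_ge0 | nra].
have k2 : 2 * C ^+ 2 * e2 * a ^+ 2 <= 4^-1 * a ^+ 2.
  by apply: ler_wpM2r; [exact: sqr_ge0 | nra].
(* The two inequalities of [nearest_prox] add up to [a ^+ 2 - b * a <= a ^+ 2 / 2], after
   Cauchy-Schwarz on [M1 - M2] and [y1 - y2]. *)
have : a ^+ 2 <= 2 * b * a by lra.
by have [->|an0] := eqVneq a 0; [lra | rewrite expr2 ler_pM2r // lt0r an0].
Qed.

(** Uniqueness is [nearest_lipschitz] with both matrices equal to [M]. *)
Lemma regular_proj_defined M : frobenius (M - zeta) < proj_radius ->
  metric_proj_defined W M.
Proof.
move=> Md; have [p0 pd pC] := proj_radiusP; have d0' := d0.
have [|y Wy ymin] := @nearest_exists M; first by lra.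
exists y; split => // z Wz zy; rewrite lt_neqAle ymin // andbT.
apply/eqP => e; apply: zy; apply/eqP; rewrite -subr_eq0; apply/eqP/frobenius0_eq0.
apply/eqP; rewrite eq_le frobenius_ge0 andbT.
have /(nearest_lipschitz Md Md Wz Wy) /(_ ymin) :
    forall w, W w -> frobenius (M - z) <= frobenius (M - w) by rewrite -e.
by rewrite subrr frobenius0 mulr0.
Qed.

Lemma regular_proj_lipschitz M1 M2 :
  frobenius (M1 - zeta) < proj_radius -> frobenius (M2 - zeta) < proj_radius ->
  frobenius (metric_proj W M1 - metric_proj W M2) <= 2 * frobenius (M1 - M2).
Proof.
move=> M1d M2d; have [D1 D2] := (regular_proj_defined M1d, regular_proj_defined M2d).
by apply: nearest_lipschitz => //; [exact: metric_proj_in | exact: metric_proj_in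
  | move=> w; exact: metric_proj_le | move=> w; exact: metric_proj_le].
Qed.

Lemma chart_graph x v : D x -> frobenius (x - zeta) < d -> frobenius (x + v - zeta) < d ->
  L x v = 0 -> frobenius (F (x + v)) <= C * frobenius v ^+ 2.
Proof.
move=> Dx xd xvd Lv; have := chart_taylor chart xd xvd Dx.
by rewrite [_ + _ - x]addrAC subrr add0r Lv subr0.
Qed.

(** A velocity is a limit of difference quotients [h], which lie in [E0] and satisfy [L x h = O(t)]
    because [F] vanishes along the curve. Conversely, retracting the line [x + t *: v] moves it by
    [O(t^2)] only, so the retracted curve has velocity [v]. *)
Lemma regular_tangent x : W x -> frobenius (x - zeta) < d ->
  tangent_vectors W x = [set v | v \in E0 /\ L x v = 0].
Proof.
move=> [Ex Dx] xd; have C1' := C1; apply/seteqP; split => v /=.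
- move=> [g [g0 gW /is_derive0P gv]].
  (* Closeness of the quotient to [v] is also used at tolerance 1: it bounds [g t - x] by
     [t * (1 + frobenius v)], and [t < f] then keeps [g t] inside the chart. *)
  have near e : 0 < e -> exists t, [/\ t != 0, `|t| < e, W (g t),
      frobenius (g t - zeta) < d & frobenius (t^-1 *: (g t - x) - v) < e].
    move=> e0; move/nbhs_ballP: gW => [a /= a0 aW].
    have [b b0 bv] := gv _ e0; have [c c0 cv] := gv 1 ltr01.
    pose f := (d - frobenius (x - zeta)) / (frobenius v + 1).
    have f0 : 0 < f by rewrite divr_gt0 ?subr_gt0 //; have := frobenius_ge0 v; lra.
    pose t := Num.min (Num.min e a) (Num.min (Num.min b c) f) / 2.
    have t0 : 0 < t by rewrite divr_gt0 // !lt_min e0 a0 b0 c0.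
    have tm : t < Num.min (Num.min e a) (Num.min (Num.min b c) f).
      by rewrite /t in t0 *; lra.
    move: tm; rewrite !lt_min => /andP[/andP[te ta] /andP[/andP[tb tc] tf]].
    have nt : `|t| = t by rewrite ger0_norm // ltW.
    exists t; rewrite nt gt_eqF //; split => //.
    + by apply: aW; rewrite /ball /= sub0r normrN nt.
    + have := cv t; rewrite nt gt_eqF // => /(_ isT tc); rewrite g0 => h.
      have := frobeniusD (t^-1 *: (g t - x) - v) v; rewrite subrK frobeniusZ.
      rewrite ger0_norm ?invr_ge0 ?(ltW t0) // => h2.
      have h3 : frobenius (g t - x) <= t * (1 + frobenius v).
        rewrite -ler_pdivrMl //; lra.
      have := frobenius_dist_tri x (g t) zeta.
      have : f * (frobenius v + 1) = d - frobenius (x - zeta).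
        by rewrite divfK // gt_eqF //; have := frobenius_ge0 v; lra.
      have := frobenius_ge0 v; nra.
    + by have := bv t; rewrite nt gt_eqF // g0; apply.
  split.
    suff : [set` E0] v by [].
    apply: (closed_frobenius (@closed_vspace _ _ _ E0)) => e e0.
    have [t [t0 te [Egt _] _ he]] := near e e0.
    by exists (t^-1 *: (g t - x)) => //=; rewrite memvZ // affine_sub.
  apply: frobenius0_eq0; apply/eqP; rewrite eq_le frobenius_ge0 andbT.
  apply: (le_eps_le0 (b := C + C * (frobenius v + 1) ^+ 2)) => e e0 e1.
  have [t [t0 te [_ Dgt] gd he]] := near e e0.
  set h := t^-1 *: (g t - x) in he.
  have gE : g t - x = t *: h by rewrite /h scalerA divff // scale1r.
  have Lh : frobenius (L x h) <= C * (`|t| * frobenius h ^+ 2).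
    have := chart_taylor chart xd gd Dx; move/(chartE chart gd): Dgt => ->.
    rewrite sub0r frobeniusN gE linearZ /= !frobeniusZ exprMn => H.
    have nt0 : 0 < `|t| by rewrite normr_gt0.
    rewrite -(ler_pM2l nt0); nra.
  have hv : frobenius h <= frobenius v + 1.
    by have := frobeniusD (h - v) v; rewrite subrK; lra.
  have Lvh := chart_bounded chart (h - v) xd.
  have := frobeniusB (L x h) (L x (h - v)); rewrite -linearB subKr => Lv.
  have h2 : frobenius h ^+ 2 <= (frobenius v + 1) ^+ 2.
    by rewrite ler_pXn2r ?nnegrE // addr_ge0.
  have : `|t| * frobenius h ^+ 2 <= e * (frobenius v + 1) ^+ 2.
    by apply: ler_pM => //; [exact: sqr_ge0 | exact: ltW].
  nra.
- move=> [vE0 Lv].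
  pose f := (d - frobenius (x - zeta)) / (frobenius v + 1).
  have v1 : 0 < frobenius v + 1 by have := frobenius_ge0 v; lra.
  have f0 : 0 < f by rewrite divr_gt0 ?subr_gt0.
  have fE : f * (frobenius v + 1) = d - frobenius (x - zeta).
    by rewrite divfK // gt_eqF.
  have xtd t : `|t| < f -> frobenius (x + t *: v - zeta) < d.
    move=> tf; rewrite addrAC; apply: le_lt_trans (frobeniusD _ _) _.
    by rewrite frobeniusZ; have := frobenius_ge0 v; nra.
  have Ext t : E (x + t *: v) by apply: affine_add => //; rewrite memvZ.
  (* [F x = 0] forces the retraction to fix [x], so the curve does start at [x]. *)
  have sx : s x = x.
    have [_] := retract Ex xd; move/(chartE chart xd): (Dx) => ->.
    rewrite frobenius0 mulr0 => h; apply/eqP; rewrite -subr_eq0; apply/eqP/frobenius0_eq0.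
    by apply/eqP; rewrite eq_le h /=.
  exists (fun t => s (x + t *: v)); split; first by rewrite scale0r addr0.
    apply/nbhs_ballP; exists f => // t; rewrite /ball /= sub0r normrN => tf.
    by have [] := retract (Ext t) (xtd t tf).
  apply/is_derive0P => e e0.
  pose K := C * C * frobenius v ^+ 2 + 1.
  have K0 : 0 < K by rewrite /K; have := sqr_ge0 (frobenius v); nra.
  exists (Num.min f (e / K)) => [|t t0]; first by rewrite lt_min f0 divr_gt0.
  rewrite lt_min => /andP[tf]; rewrite ltr_pdivlMr // => te.
  have [_ sxt] := retract (Ext t) (xtd t tf).
  have Fxt := chart_graph Dx xd (xtd t tf).
  rewrite linearZ /= Lv scaler0 frobeniusZ exprMn in Fxt; move: (Fxt erefl) => {}Fxt.
  rewrite scale0r addr0 sx.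
  have -> : t^-1 *: (s (x + t *: v) - x) - v = t^-1 *: (s (x + t *: v) - (x + t *: v)).
    by rewrite opprD addrA [in RHS]scalerBr scalerA mulVf // scale1r.
  rewrite frobeniusZ normfV mulrC ltr_pdivrMr ?normr_gt0 //.
  have nt0 : 0 < `|t| by rewrite normr_gt0.
  have v2 := sqr_ge0 (frobenius v).
  apply: (@le_lt_trans _ _ (`|t| * K * `|t|)); last by rewrite ltr_pM2r.
  apply: le_trans sxt _; apply: le_trans (ler_wpM2l _ Fxt) _; first lra.
  rewrite /K; nra.
Qed.

End RegularIntersection.
(** * The alternating tangent projection and its limit *)

(** Arithmetic for [phi_continuous]: [g < 1] and [g < e ^+ 2 / 256] give
    [s ^+ 2 <= 32 * g < (e / 2) ^+ 2]. *)
Lemma stability_bound {R : realType} (e g a s t : R) : 0 < e -> 0 <= g ->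
  g < Num.min 1 (Num.min (e / 2) (e ^+ 2 / 4 / 64)) -> t <= g -> 0 <= s -> a <= 2 ->
  s ^+ 2 <= 8 * g * a + 16 * g ^+ 2 -> t + s < e.
Proof.
move=> e0 g0; rewrite !lt_min => /andP[g1 /andP[g2 g3]] tg s0 a2 sg.
have e20 : 0 <= e / 2 by rewrite divr_ge0 // ltW.
have s2 : s ^+ 2 < (e / 2) ^+ 2 by nra.
have : s < e / 2 by rewrite -(@ltr_pXn2r _ 2) ?nnegrE.
lra.
Qed.

Section Phi.
Context {R : realType} {p q r k l : nat}.
Local Notation V := 'M[R]_(p, q).
Local Notation Z := 'M[R]_(k, l).
Local Notation D := (rank_manifold R p q r).
Variables (E : set V) (E0 : {vspace V}) (zeta : V).
Variables (F : V -> Z) (L : V -> {linear V -> Z}) (rho : V -> V) (d C : R).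
Hypothesis chart : is_chart D zeta F L d C.
Hypothesis d1 : d <= 1.
Hypothesis EP : forall x, E x <-> x - zeta \in E0.
Hypothesis Dzeta : D zeta.
Hypothesis retract : forall x, frobenius (x - zeta) < d ->
  D (rho x) /\ frobenius (rho x - x) <= C * frobenius (F x).
Hypothesis solve : forall x z, frobenius (x - zeta) < d ->
  exists u, [/\ u \in E0, L x u = z & frobenius u <= C * frobenius z].

Let d0 : 0 < d. Proof. exact: chart_radius_gt0 chart. Qed.
Let C1 : 1 <= C. Proof. exact: chart_cst_ge1 chart. Qed.
Let C0 : 0 <= C. Proof. exact: le_trans ler01 C1. Qed.

(** The whole space in the role of [E]: the results on regular intersections then apply to the rank
    manifold alone. *)
Let fullP (x : V) : [set: V] x <-> x - zeta \in fullv.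
Proof. by split=> // _; exact: memvf. Qed.

Let retractT x : [set: V] x -> frobenius (x - zeta) < d ->
  ([set: V] `&` D) (rho x) /\ frobenius (rho x - x) <= C * frobenius (F x).
Proof. by rewrite setTI => _; exact: retract. Qed.

Local Notation eta := (proj_radius d C).
Local Notation PD := (metric_proj D).

Lemma rank_proj_defined M : frobenius (M - zeta) < eta -> metric_proj_defined D M.
Proof.
by move=> Md; have := regular_proj_defined chart d1 fullP Dzeta retractT Md; rewrite setTI.
Qed.

Lemma rank_proj_lipschitz M M' : frobenius (M - zeta) < eta ->
  frobenius (M' - zeta) < eta -> frobenius (PD M - PD M') <= 2 * frobenius (M - M').
Proof.
move=> Md M'd.
by have := regular_proj_lipschitz chart d1 fullP Dzeta retractT Md M'd; rewrite setTI.
Qed.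

Lemma rank_proj_near M : frobenius (M - zeta) < eta ->
  [/\ D (PD M), frobenius (PD M - zeta) <= 2 * frobenius (M - zeta),
      frobenius (PD M - zeta) < d
    & frobenius (M - PD M) <= C * frobenius (F M)].
Proof.
move=> Md; have DM := rank_proj_defined Md.
have [e0 ed _] := proj_radiusP chart d1.
have h : frobenius (PD M - zeta) <= 2 * frobenius (M - zeta).
  rewrite -{1}(metric_proj_id Dzeta) rank_proj_lipschitz //.
  by rewrite subrr frobenius0.
have d0' := d0; split => //; [exact: metric_proj_in | lra |].
have [Drho le_rho] := retract (lt_le_trans Md (le_trans ed (ltac:(lra) : d / 8 <= d))).
by apply: le_trans (metric_proj_le DM Drho) _; rewrite frobeniusBC.
Qed.

Lemma phi_targetE M : frobenius (M - zeta) < eta ->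
  phi_target E r M = [set y | E y /\ L (PD M) (y - PD M) = 0].
Proof.
move=> Md; have [Dx _ xd _] := rank_proj_near Md.
have TE : tangent_vectors D (PD M) = [set v | v \in fullv /\ L (PD M) v = 0].
  have := regular_tangent chart fullP retractT (x := PD M); rewrite setTI; exact.
rewrite /phi_target /tangent_space TE; apply/seteqP; split => y /=.
  by move=> [Ey [v [_ Lv] vy]]; subst y; split => //; rewrite [_ + v]addrC addrK.
move=> [Ey Ly]; split => //; exists (y - PD M); last by rewrite addrC subrK.
by split => //; exact: memvf.
Qed.

(** The form in which transversality is used: a point of [E] is moved into the target at a cost
    proportional to its residual. The estimates on [phi] compare it with competitors built in this
    way. *)
Lemma phi_target_correct M y : frobenius (M - zeta) < eta -> E y ->
  exists y', [/\ phi_target E r M y' &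
    frobenius (y' - y) <= C * frobenius (L (PD M) (y - PD M))].
Proof.
move=> Md Ey; have [Dx _ xd _] := rank_proj_near Md.
have [u [uE Lu uC]] := solve (- L (PD M) (y - PD M)) xd.
exists (y + u); rewrite phi_targetE //; split; last by rewrite addrC addKr -(frobeniusN (L _ _)).
split; first by apply/EP; rewrite addrAC memvD //; exact/EP.
by rewrite addrAC linearD /= Lu subrr.
Qed.

Lemma phi_target_line_closed M : frobenius (M - zeta) < eta ->
  line_closed (phi_target E r M).
Proof.
move=> Md a b t; rewrite phi_targetE // => -[Ea La] [Eb Lb].
have Eab : b - a \in E0.
  have -> : b - a = (b - zeta) - (a - zeta) by rewrite opprB addrA subrK.
  by apply: memvB; exact/EP.
split; first by apply/EP; rewrite addrAC memvD ?memvZ //; exact/EP.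
have -> : a + t *: (b - a) - PD M = (a - PD M) + t *: ((b - PD M) - (a - PD M)).
  by rewrite addrAC opprB addrA subrK.
rewrite [LHS]linearD [X in _ + X]linearZ /= [X in _ + _ *: X]linearB /= La Lb.
by rewrite subrr scaler0 addr0.
Qed.

Lemma phi_target_proj_defined M : frobenius (M - zeta) < eta ->
  metric_proj_defined (phi_target E r M) M.
Proof.
move=> Md; apply: line_closed_metric_proj_defined (phi_target_line_closed Md) _ _.
  rewrite phi_targetE //; apply: closedI; first exact: affine_closed EP.
  have [c c1 cL] := linear_frobenius_bounded (L (PD M)).
  apply: frobenius_closed => y H /=; apply: frobenius0_eq0; apply/eqP.
  rewrite eq_le frobenius_ge0 andbT; apply: (le_eps_le0 (b := c)) => t t0 _.
  have [z /= Lz zy] := H t t0.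
  have := cL (y - z); have -> : y - z = (y - PD M) - (z - PD M).
    by rewrite opprB addrA subrK.
  rewrite linearB /= Lz subr0 opprB addrA subrK (frobeniusBC y z).
  by move=> /le_trans; apply; nra.
have [y [Ty _]] := phi_target_correct Md (affine_base EP).
by exists y.
Qed.

Lemma phi_defined_near M : frobenius (M - zeta) < eta -> phi_defined E r M.
Proof. by move=> Md; split; [exact: rank_proj_defined | exact: phi_target_proj_defined]. Qed.

Lemma phi_in M : frobenius (M - zeta) < eta ->
  E (phi E r M) /\ L (PD M) (phi E r M - PD M) = 0.
Proof.
by move=> Md; have := metric_proj_in (phi_target_proj_defined Md); rewrite -/(phi E r M) {1}phi_targetE.
Qed.

Lemma phi_le M y : frobenius (M - zeta) < eta -> phi_target E r M y ->
  frobenius (M - phi E r M) <= frobenius (M - y).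
Proof. by move=> Md; exact/metric_proj_le/phi_target_proj_defined. Qed.

Lemma chart_zeta x : D x -> frobenius (x - zeta) < d ->
  frobenius (L x (zeta - x)) <= C * frobenius (x - zeta) ^+ 2.
Proof.
move=> Dx xd; have zd : frobenius (zeta - zeta) < d by rewrite subrr frobenius0.
have := chart_taylor chart xd zd Dx; move/(chartE chart zd): Dzeta => ->.
by rewrite sub0r frobeniusN (frobeniusBC zeta).
Qed.

Lemma chart_le M : frobenius (M - zeta) < d -> frobenius (F M) <= 2 * C * frobenius (M - zeta).
Proof.
move=> Md; have zd : frobenius (zeta - zeta) < d by rewrite subrr frobenius0.
have := chart_taylor chart zd Md Dzeta; have := chart_bounded chart (M - zeta) zd.
have := frobeniusD (F M - L zeta (M - zeta)) (L zeta (M - zeta)); rewrite subrK.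
have h2 : frobenius (M - zeta) ^+ 2 <= frobenius (M - zeta).
  by have := frobenius_ge0 (M - zeta); have := d1; nra.
by have := ler_wpM2l C0 h2; lra.
Qed.

(** The competitor is the correction of [zeta], whose residual is a Taylor remainder; the constant
    obtained is [2 + 4 * C ^+ 2]. *)
Lemma phi_dist M : frobenius (M - zeta) < eta ->
  frobenius (phi E r M - zeta) <= 6 * C ^+ 2 * frobenius (M - zeta).
Proof.
move=> Md; have [Dx xM xd _] := rank_proj_near Md.
have [e0 ed _] := proj_radiusP chart d1; have [d1' d0'] := (d1, d0).
have [y [Ty yz]] := phi_target_correct Md (affine_base EP).
have := phi_le Md Ty; have := frobenius_dist_tri M (phi E r M) zeta.
have := frobenius_dist_tri zeta M y; rewrite (frobeniusBC zeta y) (frobeniusBC _ M).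
have := chart_zeta Dx xd; set h := frobenius (M - zeta) in xM Md *.
have h0 : 0 <= h := frobenius_ge0 _.
have x2 : frobenius (PD M - zeta) ^+ 2 <= 4 * h.
  by have := frobenius_ge0 (PD M - zeta); nra.
have := ler_wpM2l C0 yz; have := ler_wpM2l C0 x2 => k1 k2 Lz.
have : C * frobenius (L (PD M) (zeta - PD M)) <= C * (C * (4 * h)).
  by apply: ler_wpM2l => //; lra.
have : h <= C ^+ 2 * h by rewrite ler_peMl // exprn_ege1.
by lra.
Qed.

(** [phi M] solves the equation linearised at [PD M], so its residual is a pure Taylor remainder:
    the quadratic gain of Newton's method. *)
Lemma phi_chart M : frobenius (M - zeta) < eta -> frobenius (phi E r M - zeta) < d ->
  frobenius (F (phi E r M)) <= C * frobenius (phi E r M - PD M) ^+ 2.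
Proof.
move=> Md phid; have [Dx _ xd _] := rank_proj_near Md; have [_ Lphi] := phi_in Md.
by have := chart_taylor chart xd phid Dx; rewrite Lphi subr0.
Qed.

(** The competitor is [M] itself, corrected. The three factors [C] come from the correction, the
    bound on [L] and the distance of [M] to the rank manifold. *)
Lemma phi_step_affine M : E M -> frobenius (M - zeta) < eta ->
  frobenius (phi E r M - M) <= C ^+ 3 * frobenius (F M).
Proof.
move=> EM Md; have [Dx _ xd Mx] := rank_proj_near Md.
have [y [Ty yM]] := phi_target_correct Md EM.
rewrite (frobeniusBC _ M); have := phi_le Md Ty; rewrite (frobeniusBC M y) => /le_trans; apply.
apply: le_trans yM _; have := chart_bounded chart (M - PD M) xd => LM.
have := ler_wpM2l C0 (le_trans LM (ler_wpM2l C0 Mx)); lra.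
Qed.

(** A point of the target at [x] nearly solves the equation of the target at [x'], since both [L]
    and the base point move by [O(t)]. The factor [C] makes it the cost in [phi_target_correct]. *)
Lemma chart_residual x x' y t : frobenius (x - zeta) < d -> frobenius (x' - zeta) < d ->
  frobenius (x' - x) <= 2 * t -> frobenius (y - zeta) <= 1 -> L x (y - x) = 0 ->
  C * frobenius (L x' (y - x')) <= 6 * C ^+ 2 * t.
Proof.
move=> xd xd' xx' yz Lyx.
have t0 : 0 <= t by have := frobenius_ge0 (x' - x); clear Lyx; lra.
have : frobenius (L x' (y - x')) <= C * frobenius (x' - x) * frobenius (y - x) + C * frobenius (x' - x).
  have -> : L x' (y - x') = (L x' (y - x) - L x (y - x)) + L x' (x - x').
    by rewrite Lyx subr0 -linearD addrA subrK.
  apply: le_trans (frobeniusD _ _) _; apply: lerD; first exact: (chart_lipschitz chart _ xd' xd).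
  by rewrite (frobeniusBC x' x); exact: (chart_bounded chart _ xd').
clear Lyx => h; have [C0' C1' d1'] := And3 C0 C1 d1.
have yN : frobenius (y - x) <= 2.
  by have := frobenius_dist_tri zeta y x; have := frobeniusBC zeta x; lra.
have h2 := ler_wpM2l C0' xx'.
have h5 : C * frobenius (x' - x) * frobenius (y - x) <= C * (2 * t) * 2.
  by apply: ler_pM => //; rewrite mulr_ge0.
have h6 : frobenius (L x' (y - x')) <= 6 * C * t by lra.
by have := ler_wpM2l C0' h6; lra.
Qed.

(** Each of [phi M] and [phi M'] is corrected into the other's target at a cost [O(|M' - M|)], so
    [nearest_stability] applies. The square root it loses is harmless: continuity is all that the
    passage to iterates needs. *)
Lemma phi_continuous M e : frobenius (M - zeta) < eta -> 0 < e ->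
  exists2 a : R, 0 < a & forall M', frobenius (M' - zeta) < eta ->
    frobenius (M' - M) < a -> frobenius (phi E r M' - phi E r M) < e.
Proof.
move=> Md e0; have [d1' d0' C1' C0'] := And4 d1 d0 C1 C0.
have [eta0 etad etaC] := proj_radiusP chart d1.
have C2 : 1 <= C ^+ 2 by rewrite exprn_ege1.
have [Dx xM xd _] := rank_proj_near Md.
have Mphi_le y : frobenius (y - zeta) <= 1 -> frobenius (M - zeta) + frobenius (zeta - y) <= 2.
  by rewrite (frobeniusBC zeta y); lra.
have bnd N : frobenius (N - zeta) < eta -> frobenius (phi E r N - zeta) <= 1.
  by move=> Nd; apply: le_trans (phi_dist Nd) _; nra.
pose c := 6 * C ^+ 2.
have c1 : 1 <= c by rewrite /c; lra.
have c0 : 0 < c by exact: lt_le_trans ltr01 c1.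
pose f := Num.min 1 (Num.min (e / 2) (e ^+ 2 / 4 / 64)).
have f0 : 0 < f by rewrite !lt_min ltr01 !divr_gt0 // exprn_gt0.
exists (f / c) => [|M' M'd]; first exact: divr_gt0.
rewrite ltr_pdivlMr // => M'M.
have [Dx' xM' xd' _] := rank_proj_near M'd.
have xx' : frobenius (PD M' - PD M) <= 2 * frobenius (M' - M) by exact: rank_proj_lipschitz.
have [Ephi Lphi] := phi_in Md; have [Ephi' Lphi'] := phi_in M'd.
have [y' [Ty' y'y]] := phi_target_correct M'd Ephi.
have [y'' [Ty'' y''y]] := phi_target_correct Md Ephi'.
have r1 := chart_residual xd xd' xx' (bnd _ Md) Lphi.
rewrite frobeniusBC in xx'.
have r2 := chart_residual xd' xd xx' (bnd _ M'd) Lphi'.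
have Tphi : phi_target E r M (phi E r M) := metric_proj_in (phi_target_proj_defined Md).
have st : frobenius (y'' - phi E r M) ^+ 2 <=
    8 * (c * frobenius (M' - M)) * frobenius (M - phi E r M) +
    16 * (c * frobenius (M' - M)) ^+ 2.
  apply: (@nearest_stability _ _ _ (phi_target E r M) (phi_target E r M')
    M M' (phi E r M) (phi E r M') y') => //.
  - exact: phi_target_line_closed.
  - by move=> w; exact: phi_le.
  - by move=> w; exact: phi_le.
  - by apply: ler_peMl => //; exact: frobenius_ge0.
  - exact: le_trans y'y r1.
  - exact: le_trans y''y r2.
have Mphi : frobenius (M - phi E r M) <= 2.
  exact: le_trans (frobenius_dist_tri zeta M _) (Mphi_le _ (bnd _ Md)).
apply: le_lt_trans (frobenius_dist_tri y'' (phi E r M') (phi E r M)) _.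
rewrite (frobeniusBC (phi E r M') y'').
apply: stability_bound e0 _ _ (le_trans y''y r2) _ Mphi st => //.
  by rewrite mulr_ge0 // ltW.
by rewrite mulrC.
Qed.

End Phi.

(** * Geometric convergence, and iteration of a map that halves a residual *)

Section GeometricConvergence.
Context {R : realType} {m n : nat}.
Local Notation V := 'M[R]_(m, n).

Lemma half_pow_lt (a e : R) : 0 <= a -> 0 < e -> exists i, 2^-1 ^+ i * a < e.
Proof.
move=> a0 e0; have ae : 0 <= a / e by rewrite divr_ge0 // ltW.
exists (Num.bound (a / e)); have := archi_boundP ae; set N := Num.bound _.
rewrite ltr_pdivrMr // => aN; rewrite exprVn ltr_pdivrMl ?exprn_gt0 //.
apply: lt_le_trans aN _; rewrite ler_pM2r // -natrX ler_nat.
exact: ltnW (ltn_expl _ _).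
Qed.

Lemma geometric_cvg (u : nat -> V) (a : R) : 0 <= a ->
  (forall i j, frobenius (u (j + i)%N - u i) <= 2^-1 ^+ i * a) ->
  cvgn u /\ forall i, frobenius (limn u - u i) <= 2^-1 ^+ i * a.
Proof.
move=> a0 ua.
have cu : cvgn u.
  apply/cauchy_cvgP/cauchy_exP => e e0; have [i ie] := half_pow_lt a0 e0.
  exists (u i); exists i => // j /= ij; rewrite -ball_normE /= distrC.
  apply: le_lt_trans (mx_norm_le_frobenius _) _.
  by rewrite -(subnK ij); exact: le_lt_trans (ua _ _) ie.
split=> // i; have clB : closed [set x : V | frobenius (u i - x) <= 2^-1 ^+ i * a].
  exact: closed_frobenius_ball.
rewrite frobeniusBC; apply: (closed_cvg _ clB _ _ cu).
by exists i => // j /= ij; rewrite frobeniusBC -(subnK ij); exact: ua.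
Qed.

End GeometricConvergence.

Section Iteration.
Context {R : realType} {m n k l : nat}.
Local Notation V := 'M[R]_(m, n).
Local Notation Z := 'M[R]_(k, l).
Variables (E : set V) (zeta : V) (f : V -> V) (F : V -> Z) (eta K : R).
Hypotheses (eta0 : 0 < eta) (K1 : 1 <= K).
Hypothesis f_dist : forall M, frobenius (M - zeta) < eta ->
  E (f M) /\ frobenius (f M - zeta) <= K * frobenius (M - zeta).
Hypothesis f_step : forall M, E M -> frobenius (M - zeta) < eta ->
  frobenius (f M - M) <= K * frobenius (F M) /\
  frobenius (F (f M)) <= 2^-1 * frobenius (F M).
Hypothesis F_le : forall M, frobenius (M - zeta) < eta ->
  frobenius (F M) <= K * frobenius (M - zeta).
Hypothesis f_cont : forall M e, frobenius (M - zeta) < eta -> 0 < e ->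
  exists2 a : R, 0 < a & forall M', frobenius (M' - zeta) < eta ->
    frobenius (M' - M) < a -> frobenius (f M' - f M) < e.

(** The weight [2 * K] makes the sum decrease along the orbit: a step moves the point by at most
    [K * frobenius (F M)], while halving [F] releases as much. *)
Definition basin : set V :=
  [set M | E M /\ frobenius (M - zeta) + 2 * K * frobenius (F M) < eta].

(** Chosen so that one step from any point of the ball, in [E] or not, lands in the basin: the
    distance is multiplied by at most [K], and [F] is at most [K] times the new distance. *)
Definition basin_radius := eta / (K * (1 + 2 * K ^+ 2)).

Lemma basin_near M : basin M -> frobenius (M - zeta) < eta.
Proof. by move=> [_]; have := frobenius_ge0 (F M); have := K1; nra. Qed.

Lemma basin_step M : basin M -> basin (f M).
Proof.
move=> bM; have Md := basin_near bM; have [EM Me] := bM.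
have [Ef _] := f_dist Md; have [fM FM] := f_step EM Md; split => //.
have := frobenius_dist_tri M (f M) zeta; have := K1; nra.
Qed.

Lemma basin_iter M i : basin M -> basin (iter i f M).
Proof. by move=> bM; elim: i => //= i; exact: basin_step. Qed.

Lemma basin_iter_F M i : basin M ->
  frobenius (F (iter i f M)) <= 2^-1 ^+ i * frobenius (F M).
Proof.
move=> bM; elim: i => [|i IH]; first by rewrite expr0 mul1r.
have bi := basin_iter i bM; have [_ /= h] := f_step (proj1 bi) (basin_near bi).
by apply: le_trans h _; rewrite exprS -mulrA ler_wpM2l.
Qed.

Lemma basin_iter_dist M i : basin M ->
  frobenius (iter i f M - M) <= 2 * K * frobenius (F M).
Proof.
have K0 : 0 <= K by exact: le_trans ler01 K1.
elim: i M => [|i IH] M bM; first by rewrite subrr frobenius0 !mulr_ge0.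
rewrite iterSr; have := IH _ (basin_step bM).
have [fM FM] := f_step (proj1 bM) (basin_near bM).
have := frobenius_dist_tri (f M) (iter i f (f M)) M.
by have := ler_wpM2l K0 FM; lra.
Qed.

Lemma basin_cvg M : basin M -> cvgn (fun i => iter i f M) /\
  forall i, frobenius (limn (fun i => iter i f M) - iter i f M) <=
            2^-1 ^+ i * (2 * K * frobenius (F M)).
Proof.
have K0 : 0 <= K by exact: le_trans ler01 K1.
move=> bM; apply: geometric_cvg => [|i j]; first by rewrite !mulr_ge0.
rewrite iterD; apply: le_trans (basin_iter_dist _ (basin_iter i bM)) _.
rewrite mulrCA; apply: ler_wpM2l; first by rewrite mulr_ge0.
exact: basin_iter_F.
Qed.

Lemma basin_radiusP : [/\ 0 < basin_radius, basin_radius <= eta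
  & K * (1 + 2 * K ^+ 2) * basin_radius = eta].
Proof.
have K0 : 0 < K by exact: lt_le_trans ltr01 K1.
have c0 : 1 <= K * (1 + 2 * K ^+ 2).
  by rewrite mulr_ege1 // lerDl mulr_ge0 // sqr_ge0.
have e : K * (1 + 2 * K ^+ 2) * basin_radius = eta.
  by rewrite mulrC divfK // gt_eqF //; exact: lt_le_trans ltr01 c0.
have r0 : 0 < basin_radius by rewrite divr_gt0 //; exact: lt_le_trans ltr01 c0.
by split => //; rewrite -{1}e ler_peMl // ltW.
Qed.

Lemma affine_basin M : E M -> frobenius (M - zeta) < basin_radius -> basin M.
Proof.
move=> EM Md; have [r0 re eE] := basin_radiusP; have K1' := K1.
have := F_le (lt_le_trans Md re); split => //.
have h0 := frobenius_ge0 (M - zeta).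
have : 2 * K * frobenius (F M) <= 2 * K * (K * frobenius (M - zeta)).
  by apply: ler_wpM2l => //; lra.
have : (1 + 2 * K ^+ 2) * basin_radius <= eta.
  by rewrite -{1}eE -mulrA ler_peMl // mulr_ge0 ?ltW //; have := sqr_ge0 K; lra.
have : (1 + 2 * K ^+ 2) * frobenius (M - zeta) < (1 + 2 * K ^+ 2) * basin_radius.
  by rewrite ltr_pM2l //; have := sqr_ge0 K; lra.
lra.
Qed.

Lemma basin_image M : frobenius (M - zeta) < basin_radius -> basin (f M).
Proof.
move=> Md; have [r0 re eE] := basin_radiusP; have K1' := K1.
have K0 : 0 < K by exact: lt_le_trans ltr01 K1.
have [Ef fd] := f_dist (lt_le_trans Md re); split => //.
have h0 := frobenius_ge0 (f M - zeta).
have h1 : (1 + 2 * K ^+ 2) * frobenius (f M - zeta) < eta.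
  rewrite -eE (mulrC K) -mulrA ltr_pM2l; last by have := sqr_ge0 K; lra.
  by apply: le_lt_trans fd _; rewrite ltr_pM2l.
have fe : frobenius (f M - zeta) < eta.
  by apply: le_lt_trans h1; rewrite ler_peMl //; have := sqr_ge0 K; lra.
have : 2 * K * frobenius (F (f M)) <= 2 * K * (K * frobenius (f M - zeta)).
  by apply: ler_wpM2l; [lra | exact: F_le].
lra.
Qed.

Lemma iter_near M i : frobenius (M - zeta) < basin_radius ->
  frobenius (iter i f M - zeta) < eta.
Proof.
move=> Md; have [_ re _] := basin_radiusP; case: i => [|i]; first exact: lt_le_trans re.
by rewrite iterSr; apply/basin_near/basin_iter/basin_image.
Qed.

Lemma iter_cvg M : frobenius (M - zeta) < basin_radius -> cvgn (fun i => iter i f M) /\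
  limn (fun i => iter i f M) = limn (fun i => iter i f (f M)).
Proof.
move=> Md; have [cf _] := basin_cvg (basin_image Md).
have E1 : (fun i => iter i f (f M)) = (fun i => iter (i + 1) f M).
  by apply/funext => i; rewrite addn1 iterSr.
rewrite E1 in cf *; have cM : cvgn (fun i => iter i f M).
  by apply/cvg_ex; exists (limn (fun i => iter (i + 1) f M)); rewrite -(cvg_shiftn 1).
by split => //; apply/esym/cvg_lim => //; rewrite (cvg_shiftn 1).
Qed.

Lemma iter_limit_dist M i : frobenius (M - zeta) < basin_radius ->
  frobenius (limn (fun i => iter i f M) - iter i.+1 f M) <=
  2^-1 ^+ i * (2 * K * frobenius (F (f M))).
Proof.
move=> Md; have [_ ->] := iter_cvg Md; rewrite iterSr.
by have [_] := basin_cvg (basin_image Md); exact.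
Qed.

Lemma iter_continuous M i e : frobenius (M - zeta) < basin_radius -> 0 < e ->
  exists2 a : R, 0 < a & forall M', frobenius (M' - zeta) < basin_radius ->
    frobenius (M' - M) < a -> frobenius (iter i f M' - iter i f M) < e.
Proof.
move=> Md; elim: i e => [|i IH] e e0; first by exists e.
have [b b0 bP] := f_cont (iter_near i Md) e0; have [a a0 aP] := IH b b0.
by exists a => // M' M'd M'M /=; apply: bP; [exact: iter_near | exact: aP].
Qed.

(** Uniform limit of continuous iterates: since [f M] is in the basin, the tail is at most
    [2^-1 ^+ i * eta] whatever the starting point. *)
Lemma iter_limit_continuous M : frobenius (M - zeta) < basin_radius ->
  {for M, continuous (fun M => limn (fun i => iter i f M))}.
Proof.
move=> Md A /= /nbhs_frobenius[e e0 eA]; apply/nbhs_frobenius.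
have e3 : 0 < e / 3 by rewrite divr_gt0.
have [i ie] := half_pow_lt (ltW eta0) e3.
have tail N : frobenius (N - zeta) < basin_radius ->
    frobenius (limn (fun i => iter i f N) - iter i.+1 f N) < e / 3.
  move=> Nd; apply: le_lt_trans (iter_limit_dist i Nd) _; apply: le_lt_trans ie.
  have [_ bF] := basin_image Nd; rewrite ler_wpM2l ?exprn_ge0 ?invr_ge0 //.
  by have := frobenius_ge0 (f N - zeta); lra.
have [a a0 aP] := iter_continuous i.+1 Md e3.
exists (Num.min a (basin_radius - frobenius (M - zeta))) => [|M'].
  by rewrite lt_min a0 subr_gt0.
rewrite lt_min => /andP[M'a M'M]; apply: eA.
have M'd : frobenius (M' - zeta) < basin_radius.
  by have := frobenius_dist_tri M M' zeta; lra.
have := aP M' M'd M'a; have := tail M Md; have := tail M' M'd.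
set u := limn _; set v := limn _; set u' := iter _ _ _; set v' := iter _ _ _.
have := frobenius_dist_tri u' u v; have := frobenius_dist_tri v' u' v.
by rewrite (frobeniusBC v v'); lra.
Qed.

End Iteration.

(** * Orthogonal projections, and differentiability from an estimate *)

Section OrthogonalProjection.
Context {R : realType} {m n : nat}.
Local Notation V := 'M[R]_(m, n).
Implicit Types (U : {vspace V}) (x y w : V).

(** A name for the nearest-point map of a subspace, to which the linear structure required of a
    differential can be attached. *)
Definition orth_proj U : V -> V := metric_proj [set` U].

Lemma vspace_line_closed U : line_closed [set` U].
Proof. by move=> a b t /= aU bU; rewrite memvD ?memvZ ?memvB. Qed.

Lemma vspace_proj_defined U x : metric_proj_defined [set` U] x.
Proof.
apply: line_closed_metric_proj_defined; [exact: vspace_line_closed|exact: closed_vspace|].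
by exists 0; rewrite /= mem0v.
Qed.

Lemma orth_proj_in U x : orth_proj U x \in U.
Proof. exact: (metric_proj_in (vspace_proj_defined U x)). Qed.

Lemma orth_proj_orthogonal U x w : w \in U -> mxinner (x - orth_proj U x) w = 0.
Proof.
move=> wU; have wxU : orth_proj U x + w \in U by rewrite memvD ?orth_proj_in.
have := line_closed_orthogonal (x := x) (vspace_line_closed (U := U))
  (orth_proj_in U x) wxU (fun z => metric_proj_le (vspace_proj_defined U x) (z := z)).
by rewrite [_ + w]addrC addrK.
Qed.

Lemma orth_proj_eq U x y : y \in U -> (forall w, w \in U -> mxinner (x - y) w = 0) ->
  orth_proj U x = y.
Proof.
move=> yU yo; pose z := orth_proj U x - y.
have zU : z \in U by rewrite memvB ?orth_proj_in.
have zE : z = (x - y) - (x - orth_proj U x).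
  by rewrite opprB addrC addrA subrK.
have z0 : mxinner z z = 0.
  by rewrite {1}zE mxinnerDl mxinnerNl yo // orth_proj_orthogonal // subrr.
apply/eqP; rewrite -subr_eq0 -/z; apply/eqP/frobenius0_eq0.
by rewrite /frobenius z0 sqrtr0.
Qed.

Fact orth_proj_is_linear U : linear (orth_proj U).
Proof.
move=> a x y; apply: orth_proj_eq => [|w wU].
  by rewrite memvD ?memvZ ?orth_proj_in.
have -> : a *: x + y - (a *: orth_proj U x + orth_proj U y) =
    a *: (x - orth_proj U x) + (y - orth_proj U y).
  by rewrite opprD addrACA scalerBr.
by rewrite mxinnerDl mxinnerZl !orth_proj_orthogonal // mulr0 addr0.
Qed.

HB.instance Definition _ U :=
  GRing.isLinear.Build R V V *:%R (orth_proj U) (orth_proj_is_linear U).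

Lemma orth_proj_min U x w : w \in U -> frobenius (x - orth_proj U x) <= frobenius (x - w).
Proof. exact: metric_proj_le (vspace_proj_defined U x). Qed.

Lemma frobenius_orth_proj U x : frobenius (orth_proj U x) <= frobenius x.
Proof.
have := sqr_frobeniusD (x - orth_proj U x) (orth_proj U x).
rewrite subrK orth_proj_orthogonal ?orth_proj_in // => e.
rewrite -(@ler_pXn2r _ 2) ?nnegrE // e.
by have := sqr_ge0 (frobenius (x - orth_proj U x)); lra.
Qed.

End OrthogonalProjection.

Lemma differentiable_from_estimate {R : realType} {m n : nat} (f : 'M[R]_(m, n) -> 'M[R]_(m, n))
    (P : {linear 'M[R]_(m, n) -> 'M[R]_(m, n)}) zeta (a K : R) :
  0 < a -> f zeta = zeta ->
  (forall x, frobenius (x - zeta) < a ->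
    frobenius (f x - (zeta + P (x - zeta))) ^+ 2 <= K * frobenius (x - zeta) ^+ 3) ->
  differentiable f zeta /\ 'd f zeta = P :> (_ -> _).
Proof.
move=> a0 fz fP.
have Pc : continuous P by exact: linear_mx_continuous.
have key : f \o shift zeta = cst (f zeta) + P +o_ (0 : 'M[R]_(m, n)) id.
  apply/eqaddoP => e e0; apply/nbhs_frobenius.
  have [c c0 cn] := frobenius_le_mx_norm (R := R) m n.
  (* Below [b], the bound [K * frobenius y ^+ 3] is at most the square of [e] times the sup norm of
     [y]; [c ^+ 2] pays for the change of norm. *)
  pose b := e ^+ 2 / ((`|K| + 1) * c ^+ 2).
  have Kc : 0 < (`|K| + 1) * c ^+ 2 by rewrite mulr_gt0 ?exprn_gt0 ?ltr_wpDl.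
  have b0 : 0 < b by rewrite divr_gt0 // exprn_gt0.
  have bE : b * ((`|K| + 1) * c ^+ 2) = e ^+ 2 by rewrite divfK // gt_eqF.
  exists (Num.min a b) => [|y]; first by rewrite lt_min a0.
  rewrite subr0 lt_min => /andP[ya yb]; have := fP (y + zeta).
  rewrite addrK => /(_ ya) fy.
  rewrite -[(_ - _) y]/(f (y + zeta) - (f zeta + P y)) fz.
  apply: le_trans (mx_norm_le_frobenius _) _.
  have h0 := frobenius_ge0 y; have hc := cn y; have n0 : 0 <= `|y| by [].
  rewrite -(@ler_pXn2r _ 2) ?nnegrE ?mulr_ge0 ?(ltW e0) //.
  apply: le_trans fy _; rewrite exprMn -bE exprS.
  have h2 : frobenius y ^+ 2 <= c ^+ 2 * `|y| ^+ 2.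
    by rewrite -exprMn ler_pXn2r ?nnegrE // mulr_ge0 // ltW.
  have K1 : K <= `|K| + 1 by have := ler_norm K; lra.
  have KK : 0 <= `|K| + 1 by rewrite addr_ge0.
  apply: (@le_trans _ _ ((`|K| + 1) * (b * (c ^+ 2 * `|y| ^+ 2)))); last by lra.
  apply: (@le_trans _ _ ((`|K| + 1) * (frobenius y * frobenius y ^+ 2))).
    by rewrite ler_wpM2r // mulr_ge0 ?sqr_ge0.
  by apply: ler_wpM2l => //; apply: ler_pM => //; [exact: sqr_ge0 | exact: ltW].
have dE := diff_unique Pc key; split => //.
by apply/diff_locallyP; rewrite dE.
Qed.
Lemma chart_weaken {R : realType} {m n k l : nat} (D : set 'M[R]_(m, n)) zeta
    (F : 'M[R]_(m, n) -> 'M[R]_(k, l)) L d C d' C' :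
  is_chart D zeta F L d C -> 0 < d' -> d' <= d -> C <= C' -> is_chart D zeta F L d' C'.
Proof.
move=> ch d'0 dd CC; have C1 := chart_cst_ge1 ch.
have w x : frobenius (x - zeta) < d' -> frobenius (x - zeta) < d.
  by move=> xd; exact: lt_le_trans dd.
split => //.
- exact: le_trans C1 CC.
- by move=> x /w xd; exact: (chartE ch xd).
- move=> x y /w xd /w yd Dx; apply: le_trans (chart_taylor ch xd yd Dx) _.
  exact: (ler_wpM2r (sqr_ge0 _)).
- move=> x y h /w xd /w yd; apply: le_trans (chart_lipschitz ch h xd yd) _.
  by apply: (ler_wpM2r (frobenius_ge0 h)); exact: (ler_wpM2r (frobenius_ge0 _)).
- by move=> x h /w xd; apply: le_trans (chart_bounded ch h xd) _; exact: (ler_wpM2r (frobenius_ge0 _)).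
Qed.

(** * The limit operator near [zeta] *)

Section Limit.
Context {R : realType} {p q r k l : nat}.
Local Notation V := 'M[R]_(p, q).
Local Notation Z := 'M[R]_(k, l).
Local Notation D := (rank_manifold R p q r).
Variables (E : set V) (E0 U : {vspace V}) (zeta : V).
Variables (F : V -> Z) (L : V -> {linear V -> Z}) (rho : V -> V) (d C : R).
Hypothesis chart : is_chart D zeta F L d C.
Hypothesis d1 : d <= 1.
Hypothesis EP : forall x, E x <-> x - zeta \in E0.
Hypothesis UP : forall v, v \in U <-> v \in E0 /\ L zeta v = 0.
Hypothesis Dzeta : D zeta.
Hypothesis retract : forall x, frobenius (x - zeta) < d ->
  D (rho x) /\ frobenius (rho x - x) <= C * frobenius (F x).
Hypothesis solve : forall x z, frobenius (x - zeta) < d ->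
  exists u, [/\ u \in E0, L x u = z & frobenius u <= C * frobenius z].

Let d0 : 0 < d. Proof. exact: chart_radius_gt0 chart. Qed.
Let C1 : 1 <= C. Proof. exact: chart_cst_ge1 chart. Qed.
Let C0 : 0 <= C. Proof. exact: le_trans ler01 C1. Qed.

Local Notation eta := (proj_radius d C).
Local Notation PD := (metric_proj D).
Local Notation phi := (phi E r).

(** The residual after a step is at most [4 * C ^+ 7 * frobenius (F M)] times the former one, and
    [frobenius (F M)] is at most [2 * C] times the distance to [zeta]; this radius makes the factor
    at most [d / 2], hence at most 1/2. *)
Definition phi_radius := d / (16 * C ^+ 8).
(** Dominates [6 * C ^+ 2] from [phi_dist], [C ^+ 3] from [phi_step_affine] and [2 * C] from
    [chart_le]. *)
Definition phi_cst := 6 * C ^+ 3.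

Lemma phi_radiusP : [/\ 0 < phi_radius, phi_radius <= eta
  & 16 * C ^+ 8 * phi_radius = d].
Proof.
have c0 i (c : R) : 0 < c -> 0 < c * C ^+ i.
  by move=> c0; rewrite mulr_gt0 // exprn_gt0 //; exact: lt_le_trans ltr01 C1.
split; first by rewrite divr_gt0 // c0.
  rewrite ler_pM2l // lef_pV2 ?posrE ?c0 //.
  have : C ^+ 2 <= C ^+ 8 by rewrite ler_weXn2l.
  by have := exprn_ege1 2 C1; lra.
by rewrite mulrC divfK // gt_eqF // c0.
Qed.

Lemma phi_cst_ge1 : 1 <= phi_cst.
Proof. by have := exprn_ege1 3 C1; rewrite /phi_cst; lra. Qed.

Lemma phi_radius_eta M : frobenius (M - zeta) < phi_radius -> frobenius (M - zeta) < eta.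
Proof. by case: phi_radiusP => _ le_eta _ /lt_le_trans; exact. Qed.

Lemma phi_radius_d M : frobenius (M - zeta) < phi_radius -> frobenius (M - zeta) < d.
Proof.
move/phi_radius_eta; have [_ ed _] := proj_radiusP chart d1.
by have := d0; lra.
Qed.

Lemma phi_dist_cst M : frobenius (M - zeta) < phi_radius ->
  E (phi M) /\ frobenius (phi M - zeta) <= phi_cst * frobenius (M - zeta).
Proof.
move=> /phi_radius_eta Md; split; first by case: (phi_in chart d1 EP Dzeta retract solve Md).
apply: le_trans (phi_dist chart d1 EP Dzeta retract solve Md) _; apply: ler_wpM2r => //.
rewrite /phi_cst ler_wpM2l // ler_weXn2l //; exact: C1.
Qed.

Lemma phi_near M : frobenius (M - zeta) < phi_radius -> frobenius (phi M - zeta) < d.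
Proof.
move=> Md; apply: le_lt_trans (proj2 (phi_dist_cst Md)) _.
have [r0 _ <-] := phi_radiusP; have K0 : 0 < phi_cst := lt_le_trans ltr01 phi_cst_ge1.
apply: (@lt_le_trans _ _ (phi_cst * phi_radius)); first by rewrite ltr_pM2l.
apply: ler_wpM2r; first exact: ltW.
have : C ^+ 3 <= C ^+ 8 by rewrite ler_weXn2l // C1.
by have := exprn_ege1 3 C1; rewrite /phi_cst; lra.
Qed.

Lemma F_le_cst M : frobenius (M - zeta) < phi_radius ->
  frobenius (F M) <= phi_cst * frobenius (M - zeta).
Proof.
move=> /phi_radius_d Md; apply: le_trans (chart_le chart d1 Dzeta Md) _.
apply: ler_wpM2r => //; rewrite /phi_cst.
have : C ^+ 1 <= C ^+ 3 by rewrite ler_weXn2l // C1.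
by rewrite expr1; have := C1; lra.
Qed.

Lemma phi_step_cst M : E M -> frobenius (M - zeta) < phi_radius ->
  frobenius (phi M - M) <= phi_cst * frobenius (F M) /\
  frobenius (F (phi M)) <= 2^-1 * frobenius (F M).
Proof.
move=> EM Md; have Mde := phi_radius_eta Md; have Mdd := phi_radius_d Md.
have st := phi_step_affine chart d1 EP Dzeta retract solve EM Mde.
have [_ _ _ Mx] := rank_proj_near chart d1 Dzeta retract Mde.
have Fphi := phi_chart chart d1 EP Dzeta retract solve Mde (phi_near Md).
have [r0 _ rE] := phi_radiusP; have C3 := exprn_ege1 3 C1.
have F0 := frobenius_ge0 (F M); split.
  apply: le_trans st _; apply: ler_wpM2r => //; rewrite /phi_cst; lra.
have tri := frobenius_dist_tri M (phi M) (PD M).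
have CC3 : C <= C ^+ 3 by rewrite -{1}(expr1 C) ler_weXn2l // C1.
have px : frobenius (phi M - PD M) <= 2 * C ^+ 3 * frobenius (F M).
  have := ler_wpM2r F0 CC3; lra.
have px2 : frobenius (phi M - PD M) ^+ 2 <= (2 * C ^+ 3 * frobenius (F M)) ^+ 2.
  by rewrite ler_pXn2r ?nnegrE // (le_trans _ px).
apply: le_trans Fphi _; apply: le_trans (ler_wpM2l C0 px2) _.
have FM := chart_le chart d1 Dzeta Mdd.
have C7 : 0 <= 4 * C ^+ 7 by rewrite mulr_ge0 // exprn_ge0 // C0.
have C8 : 0 < 8 * C ^+ 8 by rewrite mulr_gt0 // exprn_gt0 //; exact: lt_le_trans ltr01 C1.
have small : 4 * C ^+ 7 * frobenius (F M) <= 2^-1.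
  apply: le_trans (ler_wpM2l C7 FM) _.
  have -> : 4 * C ^+ 7 * (2 * C * frobenius (M - zeta)) = 8 * C ^+ 8 * frobenius (M - zeta) by ring.
  apply: le_trans (ler_wpM2l (ltW C8) (ltW Md)) _.
  by have := d1; lra.
by have := ler_wpM2r F0 small; lra.
Qed.

Lemma phi_continuous_cst M e : frobenius (M - zeta) < phi_radius -> 0 < e ->
  exists2 a : R, 0 < a & forall M', frobenius (M' - zeta) < phi_radius ->
    frobenius (M' - M) < a -> frobenius (phi M' - phi M) < e.
Proof.
move=> /phi_radius_eta Md e0.
have [a a0 aP] := phi_continuous chart d1 EP Dzeta retract solve Md e0.
by exists a => // M' /phi_radius_eta; exact: aP.
Qed.

Let r0 : 0 < phi_radius. Proof. by case: phi_radiusP. Qed.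

Local Notation Phi := (Phi E r).

Definition Phi_radius := basin_radius phi_radius phi_cst.
Local Notation b := Phi_radius.

Lemma Phi_radiusP : 0 < b /\ b <= phi_radius.
Proof. by case: (basin_radiusP r0 phi_cst_ge1). Qed.

Lemma Phi_radius_near M : frobenius (M - zeta) < b -> frobenius (M - zeta) < phi_radius.
Proof. by move/lt_le_trans; apply; case: Phi_radiusP. Qed.

Lemma Phi_defined_near M : frobenius (M - zeta) < b -> Phi_defined E r M.
Proof.
move=> Mb; split => [i|].
  apply: (phi_defined_near chart d1 EP Dzeta retract solve); apply: phi_radius_eta.
  exact: (iter_near r0 phi_cst_ge1 phi_dist_cst phi_step_cst F_le_cst i Mb).
by case: (iter_cvg r0 phi_cst_ge1 phi_dist_cst phi_step_cst F_le_cst Mb).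
Qed.

Lemma Phi_continuous_near M : frobenius (M - zeta) < b -> {for M, continuous Phi}.
Proof.
move=> Mb.
exact: (@iter_limit_continuous _ _ _ _ _ E zeta phi F phi_radius phi_cst
  r0 phi_cst_ge1 phi_dist_cst phi_step_cst F_le_cst phi_continuous_cst M Mb).
Qed.

Lemma Phi_affine_dist M : E M -> frobenius (M - zeta) < b ->
  frobenius (Phi M - M) <= 2 * phi_cst * frobenius (F M).
Proof.
move=> EM Mb; have bM := affine_basin r0 phi_cst_ge1 F_le_cst EM Mb.
have [_ /(_ 0%N)] := basin_cvg phi_cst_ge1 phi_dist_cst phi_step_cst bM.
by rewrite expr0 mul1r.
Qed.

Lemma Phi_phi_dist M : frobenius (M - zeta) < b ->
  frobenius (Phi M - phi M) <= 2 * phi_cst * frobenius (F (phi M)).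
Proof.
move=> Mb.
have := iter_limit_dist r0 phi_cst_ge1 phi_dist_cst phi_step_cst F_le_cst 0 Mb.
by rewrite expr0 mul1r.
Qed.

(** The iterates stay in the closed set [E], and their nearest rank [r] matrices approach the same
    limit because the residual tends to 0; [chart_closed] then puts the limit in the rank
    manifold. *)
Lemma Phi_in M : frobenius (M - zeta) < b -> (E `&` D) (Phi M).
Proof.
move=> Mb; have bM := basin_image r0 phi_cst_ge1 phi_dist_cst F_le_cst Mb.
have K0 : 0 <= phi_cst := le_trans ler01 phi_cst_ge1.
have near e : 0 < e -> exists u, [/\ E u, frobenius (u - zeta) < eta,
    frobenius (Phi M - u) < e & C * frobenius (F u) < e].
  move=> e0; set a := 2 * phi_cst * frobenius (F (phi M)).
  have a0 : 0 <= a by rewrite !mulr_ge0.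
  have Ca0 : 0 <= C * frobenius (F (phi M)) by rewrite mulr_ge0 // C0.
  (* Chosen for the sum of the two errors, the index [i] controls both. *)
  have [i ie] := half_pow_lt (addr_ge0 a0 Ca0) e0.
  have bi := basin_iter phi_cst_ge1 phi_dist_cst phi_step_cst i bM.
  have Fi := basin_iter_F phi_cst_ge1 phi_dist_cst phi_step_cst i bM.
  have dist := iter_limit_dist r0 phi_cst_ge1 phi_dist_cst phi_step_cst F_le_cst i Mb.
  have h0 : 0 <= (2^-1 : R) ^+ i by rewrite exprn_ge0 // invr_ge0.
  rewrite mulrDr in ie; exists (iter i phi (phi M)); split.
  - by case: bi.
  - by apply: phi_radius_eta; exact: (basin_near phi_cst_ge1 bi).
  - rewrite -iterSr; apply: le_lt_trans dist _; rewrite -/a.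
    by have := mulr_ge0 h0 Ca0; lra.
  - apply: le_lt_trans (ler_wpM2l C0 Fi) _; rewrite mulrCA.
    by have := mulr_ge0 h0 a0; lra.
split.
  apply: (closed_frobenius (affine_closed EP)) => e e0; have [u [Eu _ ue _]] := near e e0.
  by exists u => //; rewrite frobeniusBC.
have [_ ed _] := proj_radiusP chart d1; have d0' := d0.
apply: (proj1 (closed_frobenius (chart_closed chart) _)) => e e0.
have [|u [_ ud ue Fu]] := near (e / 2); first by rewrite divr_gt0.
have [Dx xd _ ux] := rank_proj_near chart d1 Dzeta retract ud.
exists (PD u); last first.
  apply: le_lt_trans (frobenius_dist_tri u _ _) _.
  by rewrite (frobeniusBC (PD u)) (frobeniusBC u (Defs.Phi _ _ _)); lra.
by split => //=; rewrite frobeniusBC; lra.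
Qed.

Lemma Phi_zeta : Phi zeta = zeta.
Proof.
have [b0 _] := Phi_radiusP.
have zb : frobenius (zeta - zeta) < b by rewrite subrr frobenius0.
have zd : frobenius (zeta - zeta) < d by rewrite subrr frobenius0.
have := Phi_affine_dist (affine_base EP) zb; move/(chartE chart zd): Dzeta => ->.
rewrite frobenius0 mulr0 => h; apply/eqP; rewrite -subr_eq0; apply/eqP/frobenius0_eq0.
by apply/eqP; rewrite eq_le h frobenius_ge0.
Qed.

(** [U] is the kernel of [L zeta] in [E0], identified with the tangent space of [W] in
    [intersection_tangent]. This point is the common first-order model of [phi M], [Phi M] and the
    nearest point of [W]. *)
Definition tangent_point M := zeta + orth_proj U (M - zeta).

(* [nearest_stability] for the affine space tangent to [W] at [zeta]: an error
   [O(h^2)] on the sets, with [h] the distance of [M] to [zeta], gives an error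
   [O(h^(3/2))], hence [o(h)], on the nearest points. *)
Lemma tangential_nearest (A : set V) M y y' c : 1 <= c ->
  frobenius (M - zeta) <= 1 -> E y -> A y' ->
  (forall w, A w -> frobenius (M - y) <= frobenius (M - w)) ->
  frobenius (y' - tangent_point M) <= c * frobenius (M - zeta) ^+ 2 ->
  frobenius (L zeta (y - zeta)) <= c * frobenius (M - zeta) ^+ 2 ->
  frobenius (y - tangent_point M) ^+ 2 <= 50 * (C * c) ^+ 2 * frobenius (M - zeta) ^+ 3.
Proof.
move=> c1 h1 Ey Ay' ymin y'y Ly; set h := frobenius (M - zeta) in h1 y'y Ly *.
have h0 : 0 <= h := frobenius_ge0 _; have C1' := C1; have C0' := C0.
pose A0 : set V := [set w | w - zeta \in U].
have zd : frobenius (zeta - zeta) < d by rewrite subrr frobenius0.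
(* [y + u] is [y] brought into the tangent affine space; [y'] plays the mirror role, an element of
   [A] near the tangent point. *)
have [u [uE Lu uC]] := solve (- L zeta (y - zeta)) zd.
pose e := C * c * h ^+ 2.
have h20 : 0 <= h ^+ 2 by exact: sqr_ge0.
have Cc : 1 <= C * c by exact: mulr_ege1.
have ue : frobenius u <= e.
  by apply: le_trans uC _; rewrite frobeniusN /e -mulrA; exact: ler_wpM2l.
have y'e : frobenius (y' - tangent_point M) <= e.
  by apply: le_trans y'y _; rewrite /e -mulrA ler_peMl // mulr_ge0 // (le_trans ler01).
have e0 : 0 <= e by exact: le_trans ue.
have A0l : line_closed A0.
  move=> s t a; rewrite /A0 /= => sU tU; rewrite addrAC memvD ?memvZ //.
  have -> : t - s = (t - zeta) - (s - zeta) by rewrite opprB addrA subrK.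
  exact: memvB.
have A0t : A0 (tangent_point M).
  by rewrite /A0 /= /tangent_point [zeta + _]addrC addrK orth_proj_in.
have t_min w : A0 w -> frobenius (M - tangent_point M) <= frobenius (M - w).
  rewrite /A0 /= => /(orth_proj_min (M - zeta)).
  by rewrite opprB addrA subrK /tangent_point opprD addrA.
have A0y : A0 (y + u).
  rewrite /A0 /=; apply/UP; split; first by rewrite addrAC memvD //; exact/EP.
  by rewrite addrAC linearD /= Lu subrr.
have yu : frobenius (y + u - y) <= e by rewrite [y + u]addrC addrK.
have MM : frobenius (M - M) <= e by rewrite subrr frobenius0.
have st := nearest_stability A0l A0t t_min ymin Ay' A0y MM y'e yu.
have Mt : frobenius (M - tangent_point M) <= h.
  by apply: t_min; rewrite /A0 /= subrr mem0v.
have tri := frobenius_dist_tri (y + u) y (tangent_point M).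
rewrite (frobeniusBC y (y + u)) in tri.
clear Lu A0y t_min ymin uC.
move: (frobenius_ge0 (y - tangent_point M)) tri st yu Mt.
set g := frobenius (y - tangent_point M); set s := frobenius (y + u - tangent_point M).
set w := frobenius (y + u - y); set v := frobenius (M - tangent_point M).
have s0 : 0 <= s := frobenius_ge0 _; have w0 : 0 <= w := frobenius_ge0 _.
have v0 : 0 <= v := frobenius_ge0 _.
move=> g0 tri st we vh.
(* Origin of 50: in units of [(C * c) ^+ 2 * h ^+ 3], [w ^+ 2] counts for at most 1 and [s ^+ 2] for
   at most 8 + 16. *)
have g2 : g ^+ 2 <= 2 * (w ^+ 2 + s ^+ 2) by have := sqr_ge0 (w - s); nra.
have w2 : w ^+ 2 <= e ^+ 2 by rewrite ler_pXn2r ?nnegrE.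
have ev : e * v <= e * h by exact: ler_wpM2l.
have eh : e * h <= (C * c) ^+ 2 * h ^+ 3.
  have -> : e * h = C * c * h ^+ 3 by rewrite /e; ring.
  by apply: ler_wpM2r; rewrite ?exprn_ge0 // expr2 ler_peMl // (le_trans ler01).
have e2 : e ^+ 2 <= (C * c) ^+ 2 * h ^+ 3.
  have -> : e ^+ 2 = (C * c) ^+ 2 * (h ^+ 3 * h) by rewrite /e; ring.
  by apply: ler_wpM2l; [exact: sqr_ge0 | rewrite ler_piMr // exprn_ge0].
lra.
Qed.

Lemma tangent_point_in M : E (tangent_point M).
Proof.
by apply/EP; rewrite /tangent_point [zeta + _]addrC addrK; case/UP: (orth_proj_in U (M - zeta)).
Qed.

Lemma tangent_point_dist M : frobenius (tangent_point M - zeta) <= frobenius (M - zeta).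
Proof. by rewrite /tangent_point [zeta + _]addrC addrK frobenius_orth_proj. Qed.

Lemma tangent_point_kernel M : L zeta (tangent_point M - zeta) = 0.
Proof.
by rewrite /tangent_point [zeta + _]addrC addrK; case/UP: (orth_proj_in U (M - zeta)).
Qed.

(** The two residuals are [O(h^2)]: the difference of [L (PD M)] and [L zeta] is [O(h)] and acts on
    vectors of length [O(h)], and [L (PD M) (zeta - PD M)] is a Taylor remainder. [16 * C ^+ 3]
    covers the larger one, [12 * C ^+ 3 + 4 * C]. *)
Lemma phi_tangent_estimate M : frobenius (M - zeta) < phi_radius ->
  frobenius (phi M - tangent_point M) ^+ 2 <=
  50 * (C * (16 * C ^+ 3)) ^+ 2 * frobenius (M - zeta) ^+ 3.
Proof.
move=> Md; have Mde := phi_radius_eta Md; have Mdd := phi_radius_d Md.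
have [Dx xM xd _] := rank_proj_near chart d1 Dzeta retract Mde.
have Lz := chart_zeta chart Dzeta Dx xd.
have [Ephi Lphi] := phi_in chart d1 EP Dzeta retract solve Mde.
have phiz := phi_dist chart d1 EP Dzeta retract solve Mde.
have zd : frobenius (zeta - zeta) < d by rewrite subrr frobenius0.
have [y' [Ty' y't]] := phi_target_correct chart d1 EP Dzeta retract solve Mde (tangent_point_in M).
have h0 := frobenius_ge0 (M - zeta); have C3 := exprn_ege1 3 C1.
have CC3 : C <= C ^+ 3 by rewrite -{1}(expr1 C) ler_weXn2l // C1.
have CC2 : C ^+ 2 <= C ^+ 3 by rewrite ler_weXn2l // C1.
have x2 : frobenius (PD M - zeta) ^+ 2 <= 4 * frobenius (M - zeta) ^+ 2.
  have -> : 4 * frobenius (M - zeta) ^+ 2 = (2 * frobenius (M - zeta)) ^+ 2 by ring.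
  by rewrite ler_pXn2r ?nnegrE // mulr_ge0.
have Lzx : frobenius (L (PD M) (zeta - PD M)) <= 4 * C * frobenius (M - zeta) ^+ 2.
  by apply: le_trans Lz _; have := ler_wpM2l C0 x2; clear Lphi; lra.
have h2 := sqr_ge0 (frobenius (M - zeta)).
apply: (tangential_nearest (A := phi_target E r M) (y' := y')) => //.
- by clear Lphi; lra.
- by apply: ltW; apply: lt_le_trans Mdd _; exact: d1.
- by move=> w; exact: (phi_le chart d1 EP Dzeta retract solve Mde).
- apply: le_trans y't _.
  have : frobenius (L (PD M) (tangent_point M - PD M)) <= 6 * C * frobenius (M - zeta) ^+ 2.
    have -> : L (PD M) (tangent_point M - PD M) = L (PD M) (zeta - PD M) +
        (L (PD M) (tangent_point M - zeta) - L zeta (tangent_point M - zeta)).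
      by rewrite tangent_point_kernel subr0 -linearD [in RHS]addrC addrA subrK.
    apply: le_trans (frobeniusD _ _) _.
    have := chart_lipschitz chart (tangent_point M - zeta) xd zd.
    have : C * frobenius (PD M - zeta) * frobenius (tangent_point M - zeta) <=
           C * (2 * frobenius (M - zeta)) * frobenius (M - zeta).
      apply: ler_pM; rewrite ?mulr_ge0 ?C0 //; last exact: tangent_point_dist.
      exact: (ler_wpM2l C0).
    clear Lphi; lra.
  move=> /(ler_wpM2l C0) h; apply: le_trans h _; have := ler_wpM2r h2 CC2.
  have : 0 <= C ^+ 3 * frobenius (M - zeta) ^+ 2.
    by rewrite mulr_ge0 // (le_trans ler01).
  clear Lphi; lra.
- have -> : L zeta (phi M - zeta) = (L zeta (phi M - zeta) - L (PD M) (phi M - zeta)) -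
      L (PD M) (zeta - PD M).
    have e : L (PD M) (phi M - zeta) + L (PD M) (zeta - PD M) = 0.
      by rewrite -linearD addrA subrK.
    by rewrite -addrA -opprD e subr0.
  apply: le_trans (frobeniusB _ _) _.
  have := chart_lipschitz chart (phi M - zeta) zd xd; rewrite (frobeniusBC zeta (PD M)).
  have : C * frobenius (PD M - zeta) * frobenius (phi M - zeta) <=
         C * (2 * frobenius (M - zeta)) * (6 * C ^+ 2 * frobenius (M - zeta)).
    apply: ler_pM; rewrite ?mulr_ge0 ?C0 //.
    exact: (ler_wpM2l C0).
  have := ler_wpM2r h2 CC3; clear Lphi; lra.
Qed.

(** All steps after the first move the point by [O(F (phi M)) = O(h^2)], so [Phi] inherits the
    first-order behavior of [phi]. *)
Lemma Phi_estimate : exists K, forall M, frobenius (M - zeta) < b ->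
  frobenius (Phi M - (zeta + orth_proj U (M - zeta))) ^+ 2 <= K * frobenius (M - zeta) ^+ 3.
Proof.
pose a := 2 * phi_cst * (C * (8 * C ^+ 2) ^+ 2); pose a' := 50 * (C * (16 * C ^+ 3)) ^+ 2.
exists (2 * a ^+ 2 + 2 * a') => M Mb; have Md := Phi_radius_near Mb.
have Mde := phi_radius_eta Md; have Mdd := phi_radius_d Md.
have K0 : 0 <= 2 * phi_cst by rewrite mulr_ge0 // (le_trans ler01) // phi_cst_ge1.
have h0 := frobenius_ge0 (M - zeta); have C2 := exprn_ege1 2 C1.
have est := phi_tangent_estimate Md.
have [_ xM _ _] := rank_proj_near chart d1 Dzeta retract Mde.
have phiz := phi_dist chart d1 EP Dzeta retract solve Mde.
have px : frobenius (phi M - PD M) <= 8 * C ^+ 2 * frobenius (M - zeta).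
  have := frobenius_dist_tri zeta (phi M) (PD M); rewrite (frobeniusBC zeta (PD M)).
  by have := ler_wpM2r h0 C2; lra.
have px2 : frobenius (phi M - PD M) ^+ 2 <= (8 * C ^+ 2 * frobenius (M - zeta)) ^+ 2.
  by rewrite ler_pXn2r ?nnegrE // (le_trans _ px).
have Pp : frobenius (Phi M - phi M) <= a * frobenius (M - zeta) ^+ 2.
  apply: le_trans (Phi_phi_dist Mb) _.
  have Fp := phi_chart chart d1 EP Dzeta retract solve Mde (phi_near Md).
  apply: le_trans (ler_wpM2l K0 (le_trans Fp (ler_wpM2l C0 px2))) _.
  by rewrite exprMn /a !mulrA.
have a0 : 0 <= a * frobenius (M - zeta) ^+ 2 by exact: le_trans (frobenius_ge0 _) Pp.
have Pp2 : frobenius (Phi M - phi M) ^+ 2 <= (a * frobenius (M - zeta) ^+ 2) ^+ 2.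
  by rewrite ler_pXn2r ?nnegrE.
have h4 : (a * frobenius (M - zeta) ^+ 2) ^+ 2 <= a ^+ 2 * frobenius (M - zeta) ^+ 3.
  rewrite exprMn; apply: ler_wpM2l; first exact: sqr_ge0.
  by rewrite -exprM ler_wiXn2l //; have := d1; lra.
have := frobenius_dist_tri (phi M) (Phi M) (tangent_point M).
rewrite -/(tangent_point M).
move: est Pp2 (frobenius_ge0 (Phi M - tangent_point M)); rewrite -/a'.
set u := frobenius (Phi M - tangent_point M); set v := frobenius (Phi M - phi M).
set w := frobenius (phi M - tangent_point M) => w2 v2 u0 uvw.
have u2 : u ^+ 2 <= 2 * (v ^+ 2 + w ^+ 2) by have := sqr_ge0 (v - w); nra.
lra.
Qed.

Local Notation W := (E `&` D).
Local Notation K := (2 * phi_cst).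

(** Regular intersections use the same radius and constant for the chart and the retraction; the
    chart is weakened to those of [Phi]. *)
Lemma Phi_chart : is_chart D zeta F L b K.
Proof.
have [b0 bp] := Phi_radiusP; apply: chart_weaken chart b0 _ _.
  apply: le_trans bp _; have [_ le_eta _] := phi_radiusP; apply: le_trans le_eta _.
  by have [_ ed _] := proj_radiusP chart d1; have := d0; lra.
have : C ^+ 1 <= C ^+ 3 by rewrite ler_weXn2l // C1.
by rewrite expr1 /phi_cst; have := C1; lra.
Qed.

Lemma Phi_radius_le1 : b <= 1.
Proof.
have [b0 bp] := Phi_radiusP; apply: le_trans bp _.
have [_ le_eta _] := phi_radiusP; apply: le_trans le_eta _.
by have [_ ed _] := proj_radiusP chart d1; have := d0; have := d1; lra.
Qed.

Lemma Phi_retract x : E x -> frobenius (x - zeta) < b ->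
  W (Phi x) /\ frobenius (Phi x - x) <= K * frobenius (F x).
Proof. by move=> Ex xb; split; [exact: Phi_in | exact: Phi_affine_dist]. Qed.

Lemma intersection_proj_defined M : frobenius (M - zeta) < proj_radius b K ->
  metric_proj_defined W M.
Proof. exact: (regular_proj_defined Phi_chart Phi_radius_le1 EP Dzeta Phi_retract). Qed.

Lemma intersection_tangent : tangent_vectors W zeta = [set` U].
Proof.
have [b0 _] := Phi_radiusP.
have zb : frobenius (zeta - zeta) < b by rewrite subrr frobenius0.
rewrite (regular_tangent Phi_chart EP Phi_retract (conj (affine_base EP) Dzeta) zb).
by apply/seteqP; split => v /UP.
Qed.

Lemma intersection_proj_estimate : exists c, forall M, frobenius (M - zeta) < proj_radius b K ->
  frobenius (metric_proj W M - (zeta + orth_proj U (M - zeta))) ^+ 2 <=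
  c * frobenius (M - zeta) ^+ 3.
Proof.
have Wz : W zeta := conj (affine_base EP) Dzeta.
have [b0 bp] := Phi_radiusP; have b1 := Phi_radius_le1.
have [pr0 prb _] := proj_radiusP Phi_chart b1.
have zd : frobenius (zeta - zeta) < d by rewrite subrr frobenius0.
have K1 : 1 <= K by have := phi_cst_ge1; lra.
have K0 : 0 <= K by exact: le_trans ler01 K1.
exists (50 * (C * (4 * (K * C))) ^+ 2) => M Md.
have Mb : frobenius (M - zeta) < b by lra.
have KC : 1 <= K * C by apply: mulr_ege1 => //; exact: C1.
have h2 := sqr_ge0 (frobenius (M - zeta)).
have Wd := intersection_proj_defined Md; have [Ey Dy] := metric_proj_in Wd.
have zr : frobenius (zeta - zeta) < proj_radius b K by rewrite subrr frobenius0.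
have yz : frobenius (metric_proj W M - zeta) <= 2 * frobenius (M - zeta).
  rewrite -{1}(metric_proj_id Wz).
  exact: (regular_proj_lipschitz Phi_chart b1 EP Dzeta Phi_retract).
have yd : frobenius (metric_proj W M - zeta) < d.
  apply: phi_radius_d; lra.
have tb : frobenius (tangent_point M - zeta) < b by exact: le_lt_trans (tangent_point_dist M) Mb.
(* [Phi] sends the tangent point into [W] while moving it by [O(h^2)] only, since [L zeta] vanishes
   on its offset from [zeta]. *)
apply: (tangential_nearest (A := W) (y' := Phi (tangent_point M))) => //.
- lra.
- lra.
- by apply: Phi_in.
- by move=> w; exact: metric_proj_le.
- apply: le_trans (Phi_affine_dist (tangent_point_in M) tb) _.
  have Ft : frobenius (F (tangent_point M)) <= C * frobenius (M - zeta) ^+ 2.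
    have := chart_taylor chart zd (phi_radius_d (Phi_radius_near tb)) Dzeta.
    rewrite tangent_point_kernel subr0 => /le_trans; apply; apply: (ler_wpM2l C0).
    by rewrite ler_pXn2r ?nnegrE // tangent_point_dist.
  apply: le_trans (ler_wpM2l K0 Ft) _.
  by have : 0 <= K * C * frobenius (M - zeta) ^+ 2; [rewrite mulr_ge0 //; lra | lra].
- have := chart_taylor chart zd yd Dzeta; move/(chartE chart yd): Dy => ->.
  rewrite sub0r frobeniusN => /le_trans; apply.
  have y2 : frobenius (metric_proj W M - zeta) ^+ 2 <= (2 * frobenius (M - zeta)) ^+ 2.
    by rewrite ler_pXn2r ?nnegrE // mulr_ge0.
  apply: le_trans (ler_wpM2l C0 y2) _.
  have : C * frobenius (M - zeta) ^+ 2 <= K * (C * frobenius (M - zeta) ^+ 2).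
    by apply: ler_peMl => //; rewrite mulr_ge0 // C0.
  lra.
Qed.

Lemma limit_operator_differential :
  [/\ \forall M \near zeta, Phi_defined E r M /\ {for M, continuous Phi},
      \forall M \near zeta, metric_proj_defined W M,
      Phi zeta = metric_proj W zeta /\ metric_proj W zeta = zeta,
      differentiable Phi zeta /\ differentiable (metric_proj W) zeta
    & ('d Phi zeta = 'd (metric_proj W) zeta :> (V -> V)) /\
      ('d (metric_proj W) zeta = metric_proj (tangent_vectors W zeta) :> (V -> V))].
Proof.
have Wz : metric_proj W zeta = zeta by apply: metric_proj_id; split => //; exact: affine_base EP.
have [b0 _] := Phi_radiusP.
have [pr0 _ _] := proj_radiusP Phi_chart Phi_radius_le1.
have [c cP] := Phi_estimate; have [c' cP'] := intersection_proj_estimate.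
have [dPhi PhiE] := differentiable_from_estimate b0 Phi_zeta cP.
have [dPW PWE] := differentiable_from_estimate pr0 Wz cP'.
split.
- apply/nbhs_frobenius; exists b => // M Mb.
  by split; [exact: Phi_defined_near | exact: Phi_continuous_near].
- by apply/nbhs_frobenius; exists (proj_radius b K) => // M; exact: intersection_proj_defined.
- by split; [rewrite Wz; exact: Phi_zeta | exact: Wz].
- exact: (conj dPhi dPW).
- by split; [exact: etrans PhiE (esym PWE) | rewrite intersection_tangent; exact: PWE].
Qed.

End Limit.
(** * Transversality *)

Section Transversality.
Context {R : realType} {p q k l : nat}.
Local Notation V := 'M[R]_(p, q).
Local Notation Z := 'M[R]_(k, l).

(** [T] at most halves norms, hence is injective, hence onto because source and target have the same
    dimension. *)
Lemma near_id_surjective (T : {linear Z -> Z}) :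
  (forall z, frobenius (T z - z) <= 2^-1 * frobenius z) ->
  forall w, exists2 z, T z = w & frobenius z <= 2 * frobenius w.
Proof.
move=> T1; have Tz z : frobenius z <= 2 * frobenius (T z).
  have := frobeniusB (T z) (T z - z); rewrite subKr.
  by have := T1 z; lra.
have ker0 : lker (linfun T) == 0%VS.
  apply/lker0P => x y; rewrite !lfunE /= => e; apply/eqP; rewrite -subr_eq0.
  apply/eqP/frobenius0_eq0/eqP; rewrite eq_le frobenius_ge0 andbT.
  by apply: le_trans (Tz _) _; rewrite linearB /= e subrr frobenius0 mulr0.
move=> w; have : w \in limg (linfun T) by rewrite lker0_limgf // memvf.
by move=> /memv_imgP[z _ ->]; exists z; rewrite lfunE //=; exact: Tz.
Qed.

(** Additivity of codimensions means that [E0] and [T0] span the whole space; as [f] kills [T0], its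
    restriction to [E0] is already onto. *)
Lemma transversal_section (f : {linear V -> Z}) (E0 T0 : {vspace V}) :
  (forall z, exists h, f h = z) -> (forall v, v \in T0 -> f v = 0) ->
  codim (E0 :&: T0)%VS = (codim E0 + codim T0)%N ->
  exists S : {linear Z -> V}, forall z, S z \in E0 /\ f (S z) = z.
Proof.
move=> f_surj T0P codimE.
have full : (E0 + T0)%VS = fullv.
  apply/eqP; rewrite eqEdim subvf /=.
  have := dimv_sum_cap E0 T0; have := dimvS (subvf (E0 :&: T0)%VS).
  have := dimvS (subvf E0); have := dimvS (subvf T0); move: codimE; rewrite /codim.
  by lia.
(* The projection extends the restriction of [f] to the whole space, where the generalised inverse
   lives; a second projection brings its values into [E0]. *)
pose g := (linfun f \o projv E0)%VF.
pose S : {linear Z -> V} := (projv E0 \o g^-1)%VF.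
exists S => z; rewrite /S /= comp_lfunE; split; first exact: memv_proj.
have : z \in limg g.
  have [h <-] := f_surj z.
  have /memv_addP[e eE [t tT ->]] : h \in (E0 + T0)%VS by rewrite full memvf.
  rewrite linearD /= (T0P t tT) addr0.
  have -> : f e = g e by rewrite comp_lfunE projv_id // lfunE.
  exact: memv_img (memvf _).
by move=> /limg_lfunVK; rewrite comp_lfunE lfunE.
Qed.

(** Perturbation of the section [S]: within [(2 * C * c)^-1] of [zeta], [L x \o S] differs from the
    identity by at most 1/2, hence is onto, and applying [S] to a preimage solves the equation. *)
Lemma chart_solve (D : set V) zeta (F : V -> Z) L d C (S : {linear Z -> V}) (E0 : {vspace V}) :
  is_chart D zeta F L d C -> (forall z, S z \in E0 /\ L zeta (S z) = z) ->
  exists d' C', [/\ 0 < d', 1 <= C' & forall x z, frobenius (x - zeta) < d' ->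
    exists u, [/\ u \in E0, L x u = z & frobenius u <= C' * frobenius z]].
Proof.
move=> ch SP; have [c c1 Sc] := linear_frobenius_bounded S.
have d0 := chart_radius_gt0 ch; have C1 := chart_cst_ge1 ch.
have Cc : 0 < 2 * C * c by rewrite !mulr_gt0 //; lra.
exists (Num.min d (2 * C * c)^-1), (2 * c); split; [|lra|].
  by rewrite lt_min d0 invr_gt0.
move=> x w; rewrite lt_min => /andP[xd xc].
have zd : frobenius (zeta - zeta) < d by rewrite subrr frobenius0.
pose T : {linear Z -> Z} := L x \o S.
have T1 z : frobenius (T z - z) <= 2^-1 * frobenius z.
  rewrite /T /= -{2}(proj2 (SP z)).
  apply: le_trans (chart_lipschitz ch _ xd zd) _.
  have xC : C * frobenius (x - zeta) * c <= 2^-1.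
    have : frobenius (x - zeta) * (2 * C * c) <= 1.
      by rewrite -ler_pdivlMr // mul1r ltW.
    clear T SP; lra.
  have Cx : 0 <= C * frobenius (x - zeta) by rewrite mulr_ge0 //; clear T SP; lra.
  apply: le_trans (ler_wpM2l Cx (Sc z)) _.
  by rewrite mulrA; exact: (ler_wpM2r (frobenius_ge0 z)).
have [z Tz zw] := near_id_surjective T1 w.
exists (S z); split => //; first by case: (SP z).
have c0 : 0 <= c by exact: le_trans ler01 c1.
apply: le_trans (Sc z) _; apply: le_trans (ler_wpM2l c0 zw) _.
by rewrite mulrCA mulrA.
Qed.

End Transversality.

Unset Implicit Arguments.

Theorem mainTheorem2 (R : realType) (p q r : nat)
    (E : set 'M[R]_(p, q)) (E0 : {vspace 'M[R]_(p, q)}) (zeta : 'M[R]_(p, q))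
    (hE : is_affine_space E E0)
    (hzeta : (E `&` rank_manifold R p q r) zeta)
    (htr : transversal_at E0 (rank_manifold R p q r) zeta) :
  let W := E `&` rank_manifold R p q r in
  [/\ \forall M \near zeta, Phi_defined E r M /\ {for M, continuous (Phi E r)},
      \forall M \near zeta, metric_proj_defined W M,
      Phi E r zeta = metric_proj W zeta /\ metric_proj W zeta = zeta,
      differentiable (Phi E r) zeta /\ differentiable (metric_proj W) zeta
    & ('d (Phi E r) zeta = 'd (metric_proj W) zeta :> ('M[R]_(p, q) -> 'M[R]_(p, q))) /\
      ('d (metric_proj W) zeta = metric_proj (tangent_vectors W zeta)
        :> ('M[R]_(p, q) -> 'M[R]_(p, q)))].
Proof.
have [Ez rz] := hzeta; have Dz : rank_manifold R p q r zeta := rz.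
have EP x : E x <-> x - zeta \in E0.
  have [a Ea] := hE; have [v0 v0E <-] : [set a + v | v in [set` E0]] zeta by rewrite -Ea.
  rewrite Ea; split => [[v vE <-]|xE] /=.
    by rewrite opprD addrACA subrr add0r memvB.
  exists (v0 + (x - (a + v0))); first by rewrite /= memvD.
  by rewrite addrA addrC subrK.
have [m [n [F [L [s [d [C [chart sP L_surj]]]]]]]] := rank_chart rz.
have [T0 [T0E codimE]] := htr.
have zd : frobenius (zeta - zeta) < d.
  by rewrite subrr frobenius0; exact: chart_radius_gt0 chart.
(* With the whole space in the role of [E], the tangent vectors of the rank manifold form the kernel
   of [L zeta], so the [T0] of the transversality hypothesis is that kernel. *)
have tangent : tangent_vectors (rank_manifold R p q r) zeta = [set v | v \in fullv /\ L zeta v = 0].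
  have := @regular_tangent _ _ _ _ _ (rank_manifold R p q r) [set: _] fullv zeta F L s d C chart.
  rewrite setTI; apply => //; first by move=> x; split=> // _; exact: memvf.
  by move=> x _ xd; have [] := sP x xd.
have T0P v : v \in T0 <-> L zeta v = 0.
  have -> : v \in T0 <-> [set` T0] v by [].
  by rewrite T0E tangent; split => [[]|] //; split => //; exact: memvf.
have [S SP] := transversal_section L_surj (fun v => proj1 (T0P v)) codimE.
have [d' [C' [d'0 C'1 solve]]] := chart_solve chart SP.
(* A common radius, at most 1, and a common constant for the chart, the retraction and the right
   inverses. *)
pose e := Num.min 1 (Num.min d d'); pose K := Num.max C C'.
have e0 : 0 < e by rewrite !lt_min ltr01 d'0 (chart_radius_gt0 chart).
have [ed ed'] : e <= d /\ e <= d' by rewrite /e !ge_min !lexx !orbT.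
have e1 : e <= 1 by rewrite ge_min lexx.
have [CK C'K] : C <= K /\ C' <= K by rewrite /K !le_max !lexx orbT.
apply: (@limit_operator_differential _ p q r m n E E0 (E0 :&: T0)%VS zeta F L s e K).
- exact: chart_weaken chart e0 ed CK.
- exact: e1.
- exact: EP.
- move=> v; rewrite memv_cap; split; first by move=> /andP[? /T0P].
  by move=> [-> /T0P].
- exact: Dz.
- move=> x xe; have [Ds le_s] := sP x (lt_le_trans xe ed); split => //.
  by apply: le_trans le_s _; exact: (ler_wpM2r (frobenius_ge0 _)).
- move=> x z xe; have [u [uE Lu uC]] := solve x z (lt_le_trans xe ed').
  exists u; split => //; apply: le_trans uC _; exact: (ler_wpM2r (frobenius_ge0 _)).
Qed.
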